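(* Let $(M,g)$ be a Riemannian $6$-manifold, possibly with boundary, and $A$ a connection on a vector bundle $\mathcal{V}M$ over $M$. Then $\mathcal{A}=\mathcal{E}_{\rm ren}$, where $$\mathcal{A}:=\operatorname{Tr}\Big(-\tfrac14\Delta(F^{ab}F_{ab})-j^aj_a-2F^{ab}\nabla_aj_b+4F^{ab}P_a{}^cF_{bc}+JF^{ab}F_{ab}\Big)$$ and $$\mathcal{E}_{\rm ren}:=\operatorname{Tr}\Big(-j^aj_a-\tfrac12(\nabla^cF^{ab})\nabla_cF_{ab}+6F^{ab}P_a{}^cF_{bc}-3F^{ab}\nabla_aj_b+F^{ab}W^c{}_{ab}{}^dF_{dc}+2F^{ab}F^c{}_aF_{bc}\Big).$$
   Context: All quantities are computed with respect to $g$. Manifolds are smooth and oriented; abstract indices are raised and lowered with $g$. $\nabla$ is the connection $\nabla^A$ coupled to the Levi-Civita connection of $g$; $\Delta=g^{ab}\nabla_a\nabla_b$; $F_{ab}=[\nabla^A_a,\nabla^A_b]$ acting on sections of $\mathcal{V}M$ is the $\operatorname{End}\mathcal{V}M$-valued curvature two-form; $\operatorname{Tr}$ is the fibrewise trace of endomorphisms, juxtaposition is composition; $j_a:=g^{bc}\nabla_bF_{ca}$. Curvature: $[\nabla_a,\nabla_b]v^c=R_{ab}{}^c{}_dv^d$, $Ric_{ab}=-R_{ac}{}^c{}_b=(d-2)P_{ab}+g_{ab}J$ with $J=P_a{}^a$ and $d=6$ ($P$ is the Schouten tensor), and the trace-free Weyl tensor $W$ is defined by $R_{abcd}=W_{abcd}+g_{ac}P_{bd}-g_{bc}P_{ad}+g_{bd}P_{ac}-g_{ad}P_{bc}$.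 ($\mathcal{A}$ is the boundary anomaly integrand of the renormalized Yang–Mills energy on Poincaré–Einstein 7-manifolds.) *)

(* Defs.v *)
From HB Require Import structures.
From mathcomp Require Import all_boot all_order all_algebra all_field.
From mathcomp Require Import ring.
From mathcomp Require Import all_classical all_reals all_analysis.
Import Order.TTheory GRing.Theory Num.Theory.
Import numFieldNormedType.Exports.

Set Implicit Arguments.
Unset Strict Implicit.
Unset Printing Implicit Defensive.

Local Open Scope classical_set_scope.
Local Open Scope ring_scope.

Definition halfspace (R : realType) : set 'rV[R]_6 := [set x | 0 <= x 0 ord0].
Arguments halfspace : clear implicits.

(* [cmap] and [cinv] are total functions; only their values on [cdom] and on
   [cmap @` cdom] are meaningful.  The image is open in R^6 or, for boundary
   charts, relatively open in the closed half-space. *)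
Record chart (R : realType) (X : topologicalType) := Chart {
  cdom : set X;
  cmap : X -> 'rV[R]_6;
  cinv : 'rV[R]_6 -> X;
  cdom_open : open cdom;
  cimg_open : open (cmap @` cdom) \/
    exists2 V : set 'rV[R]_6, open V & cmap @` cdom = V `&` halfspace R;
  cmapK : {in cdom, cancel cmap cinv};
  cmap_cts : {within cdom, continuous cmap};
  cinv_cts : {within cmap @` cdom, continuous cinv} }.

Definition cimg (R : realType) (X : topologicalType) (c : chart R X) :
  set 'rV[R]_6 := cmap c @` cdom c.

Section Derivatives.
Context (R : realType) (X : topologicalType) (c : chart R X).

Definition coord_shift (p : X) (a : 'I_6) (h : R) : 'rV[R]_6 :=
  cmap c p + h *: delta_mx 0 a.

Definition diffquo (a : 'I_6) (f : X -> R) (p : X) (h : R) : R :=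
  h^-1 * (f (cinv c (coord_shift p a h)) - f p).

(* Increments are restricted to those that stay in the image of the chart, so
   that derivatives transverse to the boundary are one-sided there. *)
Definition increments (a : 'I_6) (p : X) : set_system R :=
  within [set h | cimg c (coord_shift p a h)] 0^'.

Definition pd (a : 'I_6) (f : X -> R) (p : X) : R :=
  lim (diffquo a f p @ increments a p).

Fixpoint Ck (k : nat) (U : set X) (f : X -> R) : Prop :=
  {within U, continuous f} /\
  if k is k'.+1 then
    forall a : 'I_6, (forall p, U p -> cvg (diffquo a f p @ increments a p)) /\
                     Ck k' U (pd a f)
  else True.

(* At boundary points this is implied by (and, by Whitney's extension theorem,
   equivalent to) the existence of local smooth extensions. *)
Definition smooth (U : set X) (f : X -> R) : Prop := forall k, Ck k U f.

End Derivatives.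

Definition jac_chart (R : realType) (X : topologicalType) (c c' : chart R X)
    (p : X) : 'M[R]_6 :=
  \matrix_(a, b) pd c a (fun q => cmap c' q 0 b) p.

Record manifold (R : realType) (X : topologicalType) := Manifold {
  midx : Type;
  mchart : midx -> chart R X;
  m_hausdorff : hausdorff_space X;
  m_second_countable : @second_countable X;
  m_cover : forall p, exists i, cdom (mchart i) p;
  m_smooth : forall i j (b : 'I_6),
    smooth (mchart i) (cdom (mchart i) `&` cdom (mchart j))
      (fun q => cmap (mchart j) q 0 b);
  m_oriented : forall i j p, cdom (mchart i) p -> cdom (mchart j) p ->
    0 < \det (jac_chart (mchart i) (mchart j) p) }.

(* [rm_g i p] is the matrix of components g_ab(p) in the chart i. *)
Record riemannian (R : realType) (X : topologicalType) (m : manifold R X) :=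
  Riemannian {
  rm_g : midx m -> X -> 'M[R]_6;
  rm_smooth : forall i (a b : 'I_6),
    smooth (mchart i) (cdom (mchart i)) (fun p => rm_g i p a b);
  rm_sym : forall i p, cdom (mchart i) p -> (rm_g i p)^T = rm_g i p;
  rm_pos : forall i p, cdom (mchart i) p -> forall v : 'rV[R]_6, v != 0 ->
    0 < (v *m rm_g i p *m v^T) 0 0;
  rm_change : forall i j p, cdom (mchart i) p -> cdom (mchart j) p ->
    let T := jac_chart (mchart i) (mchart j) p in
    rm_g i p = T *m rm_g j p *m T^T }.

(* The scalars K of the bundle form a finite field extension of R, so that real
   (K = R) and complex (K = C) bundles are both covered.  K-valued functions
   are differentiated componentwise in an R-basis of K. *)
Section ScalarDerivatives.
Context (R : realType) (X : topologicalType) (c : chart R X).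
Context (K : fieldExtType R).

Definition pdK (a : 'I_6) (f : X -> K) (p : X) : K :=
  \sum_(k < \dim {:K})
    pd c a (fun q => coord (vbasis {:K}) k (f q)) p *: (vbasis {:K})`_k.

Definition smoothK (U : set X) (f : X -> K) : Prop :=
  forall k, smooth c U (fun q => coord (vbasis {:K}) k (f q)).

Definition pdM (m n : nat) (a : 'I_6) (f : X -> 'M[K]_(m, n)) (p : X) :
  'M[K]_(m, n) := \matrix_(i, j) pdK a (fun q => f q i j) p.

Definition smoothM (m n : nat) (U : set X) (f : X -> 'M[K]_(m, n)) : Prop :=
  forall i j, smoothK U (fun q => f q i j).

End ScalarDerivatives.

(* A vector bundle of rank r, given by a trivializing cover and its cocycle of
   transition functions: the components of a section in two trivializations
   are related by s_l = vb_trans l l' *m s_l'. *)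
Record vbundle (R : realType) (X : topologicalType) (m : manifold R X)
    (K : fieldExtType R) (r : nat) := Vbundle {
  vb_idx : Type;
  vb_dom : vb_idx -> set X;
  vb_open : forall l, open (vb_dom l);
  vb_cover : forall p, exists l, vb_dom l p;
  vb_trans : vb_idx -> vb_idx -> X -> 'M[K]_r;
  vb_smooth : forall (i : midx m) l l',
    smoothM (mchart i) (cdom (mchart i) `&` vb_dom l `&` vb_dom l')
      (vb_trans l l');
  vb_id : forall l p, vb_dom l p -> vb_trans l l p = 1%:M;
  vb_cocycle : forall l l' l'' p, vb_dom l p -> vb_dom l' p -> vb_dom l'' p ->
    vb_trans l l' p *m vb_trans l' l'' p = vb_trans l l'' p }.

Definition rscale (R : realType) (K : fieldExtType R) (m n : nat) (t : R)
  (Y : 'M[K]_(m, n)) : 'M[K]_(m, n) := (t%:A : K) *: Y.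
Notation "t *:' Y" := (rscale t Y) (at level 40) : ring_scope.

(* In the chart i and trivialization l the connection is
   nabla_a = pd_a + cn_form i l a. *)
Record connection (R : realType) (X : topologicalType) (m : manifold R X)
    (K : fieldExtType R) (r : nat) (V : vbundle m K r) := Connection {
  cn_form : midx m -> vb_idx V -> 'I_6 -> X -> 'M[K]_r;
  cn_smooth : forall i l a,
    smoothM (mchart i) (cdom (mchart i) `&` vb_dom l) (cn_form i l a);
  cn_change : forall i j l a p,
    cdom (mchart i) p -> cdom (mchart j) p -> vb_dom l p ->
    cn_form i l a p =
      \sum_b jac_chart (mchart i) (mchart j) p a b *:' cn_form j l b p;
  cn_gauge : forall i l l' a p,
    cdom (mchart i) p -> vb_dom l p -> vb_dom l' p ->
    cn_form i l a p *m vb_trans l l' p =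
      vb_trans l l' p *m cn_form i l' a p - pdM (mchart i) a (vb_trans l l') p }.

Section Metric.
Context (R : realType) (X : topologicalType) (c : chart R X).
Context (g : X -> 'M[R]_6).

Definition gup (a b : 'I_6) (p : X) : R := invmx (g p) a b.

(* Gamma^c_{ab} *)
Definition christoffel (e a b : 'I_6) (p : X) : R :=
  2^-1 * \sum_f gup e f p *
    (pd c a (fun q => g q f b) p + pd c b (fun q => g q f a) p
       - pd c f (fun q => g q a b) p).

(* nabla_a v^e *)
Definition nabla_vec (v : 'I_6 -> X -> R) (a e : 'I_6) (p : X) : R :=
  pd c a (v e) p + \sum_f christoffel e a f p * v f p.

(* nabla_a t_b^e *)
Definition nabla_mix (t : 'I_6 -> 'I_6 -> X -> R) (a b e : 'I_6) (p : X) : R :=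
  pd c a (t b e) p + \sum_f christoffel e a f p * t b f p
    - \sum_f christoffel f a b p * t f e p.

(* R_{ab}^e_f, the e-component of [nabla_a, nabla_b] applied to the f-th
   coordinate vector field. *)
Definition riem (a b e f : 'I_6) (p : X) : R :=
  let v := fun e' (_ : X) => (e' == f)%:R in
  nabla_mix (nabla_vec v) a b e p - nabla_mix (nabla_vec v) b a e p.

Definition riem_low (a b e f : 'I_6) (p : X) : R :=
  \sum_e' g p e e' * riem a b e' f p.

Definition ric (a b : 'I_6) (p : X) : R := - \sum_e riem a e e b p.

Definition scal (p : X) : R := \sum_a \sum_b gup a b p * ric a b p.

(* The solution of Ric = (d - 2) P + g J, J = P_a^a in dimension d = 6, see
   [ric_schouten]; there scal = 2 (d - 1) J. *)
Definition schouten (a b : 'I_6) (p : X) : R :=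
  4^-1 * (ric a b p - scal p / 10 * g p a b).

Definition schouten_trace (p : X) : R :=
  \sum_a \sum_b gup a b p * schouten a b p.

Definition weyl (a b e f : 'I_6) (p : X) : R :=
  riem_low a b e f p
    - (g p a e * schouten b f p - g p b e * schouten a f p
       + g p b f * schouten a e p - g p a f * schouten b e p).

(* P_a^e *)
Definition schouten_mix (a e : 'I_6) (p : X) : R :=
  \sum_f gup e f p * schouten a f p.

(* W^e_{ab}^f *)
Definition weyl_mix (e a b f : 'I_6) (p : X) : R :=
  \sum_e' \sum_f' gup e e' p * gup f f' p * weyl e' a b f' p.

Lemma ric_schouten (a b : 'I_6) (p : X) :
  (g p)^T = g p -> g p \in unitmx ->
  ric a b p = (6 - 2) * schouten a b p + g p a b * schouten_trace p.
Proof.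
move=> gT gu.
have g6 : \sum_a' \sum_b' gup a' b' p * g p a' b' = 6.
  transitivity (\tr (invmx (g p) *m (g p)^T)); last first.
    by rewrite gT mulVmx // mxtrace1.
  by apply: eq_bigr => a' _; rewrite mxE; apply: eq_bigr => b' _; rewrite mxE.
have JE : schouten_trace p = scal p / 10.
  transitivity (4^-1 * (scal p - scal p / 10 *
      \sum_a' \sum_b' gup a' b' p * g p a' b')); last first.
    by rewrite g6; field.
  rewrite mulrBr !mulr_sumr -sumrB; apply: eq_bigr => a' _.
  rewrite !mulr_sumr -sumrB; apply: eq_bigr => b' _.
  by rewrite /schouten; ring.
by rewrite JE /schouten; field.
Qed.

Section Coupled.
Context (K : fieldExtType R) (r : nat) (A : 'I_6 -> X -> 'M[K]_r).

Definition nabla_sec (a : 'I_6) (s : X -> 'cV[K]_r) (p : X) : 'cV[K]_r :=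
  pdM c a s p + A a p *m s p.

Definition nabla_end (a : 'I_6) (Y : X -> 'M[K]_r) (p : X) : 'M[K]_r :=
  pdM c a Y p + A a p *m Y p - Y p *m A a p.

(* Covariant derivatives of bundle-valued tensors with one and two lower
   indices, [D] being [nabla_sec] or [nabla_end]. *)
Definition nabla1 (n : nat)
    (D : 'I_6 -> (X -> 'M[K]_(r, n)) -> X -> 'M[K]_(r, n))
    (a : 'I_6) (t : 'I_6 -> X -> 'M[K]_(r, n)) (b : 'I_6) (p : X) :
    'M[K]_(r, n) :=
  D a (t b) p - \sum_f christoffel f a b p *:' t f p.

Definition nabla2 (n : nat)
    (D : 'I_6 -> (X -> 'M[K]_(r, n)) -> X -> 'M[K]_(r, n))
    (a : 'I_6) (t : 'I_6 -> 'I_6 -> X -> 'M[K]_(r, n)) (b e : 'I_6) (p : X) :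
    'M[K]_(r, n) :=
  D a (t b e) p - \sum_f christoffel f a b p *:' t f e p
    - \sum_f christoffel f a e p *:' t b f p.

Definition nabla_nabla_sec (a b : 'I_6) (s : X -> 'cV[K]_r) (p : X) :
  'cV[K]_r := nabla1 nabla_sec a (fun b' => nabla_sec b' s) b p.

(* F_{ab}: its j-th column is [nabla_a, nabla_b] applied to the j-th section of
   the local frame. *)
Definition curv (a b : 'I_6) (p : X) : 'M[K]_r :=
  \matrix_(i, j)
    let s := fun _ : X => delta_mx j 0 in
    (nabla_nabla_sec a b s p - nabla_nabla_sec b a s p) i 0.

(* nabla_e F_{ab} *)
Definition nabla_curv (e a b : 'I_6) (p : X) : 'M[K]_r :=
  nabla2 nabla_end e curv a b p.

Definition current (a : 'I_6) (p : X) : 'M[K]_r :=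
  \sum_b \sum_e gup b e p *:' nabla_curv b e a p.

Definition nabla_current (a b : 'I_6) (p : X) : 'M[K]_r :=
  nabla1 nabla_end a current b p.

Definition laplacian (Y : X -> 'M[K]_r) (p : X) : 'M[K]_r :=
  \sum_a \sum_b
    gup a b p *:' nabla1 nabla_end a (fun b' => nabla_end b' Y) b p.

Definition current_up (a : 'I_6) (p : X) : 'M[K]_r :=
  \sum_b gup a b p *:' current b p.

Definition curv_up (a b : 'I_6) (p : X) : 'M[K]_r :=
  \sum_e \sum_f (gup a e p * gup b f p) *:' curv e f p.

(* F^e_a *)
Definition curv_mix (e a : 'I_6) (p : X) : 'M[K]_r :=
  \sum_f gup e f p *:' curv f a p.

(* nabla^e F^{ab} *)
Definition nabla_curv_up (e a b : 'I_6) (p : X) : 'M[K]_r :=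
  \sum_e' \sum_a' \sum_b'
    (gup e e' p * gup a a' p * gup b b' p) *:' nabla_curv e' a' b' p.

Definition curv_sq (p : X) : 'M[K]_r :=
  \sum_a \sum_b curv_up a b p *m curv a b p.

Definition anomaly (p : X) : K :=
  \tr (- (4^-1 *: laplacian curv_sq p)
       - \sum_a current_up a p *m current a p
       - 2 *: \sum_a \sum_b curv_up a b p *m nabla_current a b p
       + 4 *: \sum_a \sum_b \sum_e
                curv_up a b p *m (schouten_mix a e p *:' curv b e p)
       + schouten_trace p *:' curv_sq p).

Definition energy_ren (p : X) : K :=
  \tr (- \sum_a current_up a p *m current a p
       - 2^-1 *: \sum_e \sum_a \sum_b
                   nabla_curv_up e a b p *m nabla_curv e a b p
       + 6 *: \sum_a \sum_b \sum_e
                curv_up a b p *m (schouten_mix a e p *:' curv b e p)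
       - 3 *: \sum_a \sum_b curv_up a b p *m nabla_current a b p
       + \sum_a \sum_b \sum_e \sum_f
           curv_up a b p *m (weyl_mix e a b f p *:' curv f e p)
       + 2 *: \sum_a \sum_b \sum_e
                curv_up a b p *m curv_mix e a p *m curv b e p).

End Coupled.
End Metric.

(* Main.v *)
Require Import Defs.
From mathcomp Require Import all_boot all_order all_algebra all_field.
From mathcomp Require Import ring lra.
From mathcomp Require Import all_classical all_reals all_analysis.
Import Order.TTheory GRing.Theory Num.Theory.
Import numFieldNormedType.Exports.

Set Implicit Arguments.
Unset Strict Implicit.
Unset Printing Implicit Defensive.

Local Open Scope classical_set_scope.
Local Open Scope ring_scope.

(** Write [H_cdab = nabla_c nabla_d F_ab]. Expanding the Laplacian of
    [Tr(F^ab F_ab)] by the Leibniz rule ([tr_laplacian_curv_sq]), the difference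
    of the two integrands is the trace of

      [- 1/2 F^ab H^c_cab + F^ab nabla_a j_b - 2 F^ab P_a^c F_bc + J F^ab F_ab
       - F^ab W^c_ab^d F_dc - 2 F^ab F^c_a F_bc]

    where only the first two terms contain derivatives of [F]. The Bianchi identity
    ([hess_curv_bianchi]) and the skewness of [F] give
    [F^ab H^c_cab = - 2 F^ab H^c_abc]; exchanging the derivatives in [H_cabd]
    turns it into [H_acbd], whose contraction is [- nabla_a j_b], at the price of a
    commutator ([bochner]). By the Ricci identity ([ricci_identity]) the commutator
    is the action on [F] of the curvatures of the bundle and of the metric. The
    bundle curvature contributes the commutator [[F_ca, F_bd]], that is twice the
    cubic term. The Riemann curvature contributes a Ricci term [4 P + g J] and a
    full contraction in which the decomposition into Weyl and Schouten tensors
    leaves [W] and [- 2 P] ([curvature_contraction]). The terms add up to zero.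

    This argument is pointwise once the following is known for components in a
    chart and a trivialization.

    Second partial derivatives commute, including at boundary points, where
    derivatives transverse to the boundary are one-sided ([pd_comm]). The classical
    proof by mixed differences and the mean value theorem only evaluates functions
    on a small square of nonnegative increments, and such a square lies in the
    image of the chart at every point. The symmetry is used for the connection
    form, where it gives the Bianchi identity ([curv_bianchi]) and the curvature
    of the coupled derivative ([nabla_end_comm]), and for the metric, where it
    gives the skewness of the Riemann tensor in its last two indices
    ([riemK_skew]).

    The connection is compatible with the metric: [pdM_metricK] for the metric,
    [pdM_invmetricK] for its inverse, [pdK_contr_raise2] for the pairing of
    2-tensors.

    To keep sums over indices manageable, the Christoffel symbols are treated as
    matrices [Gamma_a] and a covariant derivative of a 2-tensor [t] is written
    [D_a t - lmulT Gamma_a t - rmulT Gamma_a t], where [D_a] differentiates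
    components as endomorphisms and the two operators act on the two indices.
    These operators commute with each other and are adjoint to their transposes
    for the full contraction [contr], so that the Ricci identity, the raising of
    indices and the contractions with [P] are consequences of matrix algebra. *)

(** * Charts near interior and boundary points *)

Section ChartPoints.
Context (R : realType) (X : topologicalType) (c : chart R X).

Lemma cinv_cmap p : cdom c p -> cinv c (cmap c p) = p.
Proof. by move=> hp; exact: (cmapK (mem_set hp)). Qed.

Lemma cimg_cinv y : cimg c y -> cmap c (cinv c y) = y /\ cdom c (cinv c y).
Proof. by case=> q hq <-; rewrite cinv_cmap. Qed.

(** In both kinds of charts small steps that do not decrease the coordinate
    transverse to the boundary stay in the image. The calculus below sees the
    boundary only through this property. *)
Lemma near_cimg p : cdom c p ->
  \forall y \near nbhs (cmap c p), cmap c p 0 ord0 <= (y : 'rV[R]_6) 0 ord0 -> cimg c y.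
Proof.
move=> hp; have ip : cimg c (cmap c p) by exists p.
case: (cimg_open c) => [Uo|[V oV E]].
  have := open_nbhs_nbhs (conj Uo ip).
  by apply: filterS => y Hy _; exact: Hy.
have [Vp Hp] : (V `&` halfspace R) (cmap c p) by rewrite -E.
have := open_nbhs_nbhs (conj oV Vp).
apply: filterS => y Vy le; rewrite /cimg E; split=> //.
exact: le_trans Hp le.
Qed.

Lemma cinv_cvg p : cdom c p ->
  cinv c @ within (cimg c) (nbhs (cmap c p)) --> p.
Proof.
move=> hp; have ip : cimg c (cmap c p) by exists p.
have /subspace_continuousP/(_ _ ip) := @cinv_cts _ _ c.
move=> H; have : cinv c @ within (cimg c) (nbhs (cmap c p)) --> cinv c (cmap c p) by exact: H.
by rewrite cinv_cmap.
Qed.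

Definition shift2 (p : X) (a b : 'I_6) (s t : R) : 'rV[R]_6 :=
  cmap c p + s *: delta_mx 0 a + t *: delta_mx 0 b.

Lemma shift2_cvg p a b :
  (fun st : R * R => shift2 p a b st.1 st.2) @ ((0 : R), (0 : R)) --> cmap c p.
Proof.
have -> : nbhs (cmap c p) = nbhs (shift2 p a b 0 0) by rewrite /shift2 !scale0r !addr0.
apply: cvgD; first apply: cvgD; first exact: cvg_cst.
- by apply: cvgZr_tmp; exact: cvg_fst.
- by apply: cvgZr_tmp; exact: cvg_snd.
Qed.

Lemma shift_cvg p a : coord_shift c p a @ (0 : R) --> cmap c p.
Proof.
have -> : nbhs (cmap c p) = nbhs (coord_shift c p a 0).
  by rewrite /coord_shift scale0r addr0.
by apply: cvgD; [exact: cvg_cst | apply: cvgZr_tmp; exact: cvg_id].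
Qed.


Lemma coord_shift0 p a h : coord_shift c p a h 0 ord0 =
  cmap c p 0 ord0 + h * (a == ord0)%:R.
Proof. by rewrite !mxE eqxx /= [ord0 == a]eq_sym. Qed.

Lemma shift20 p a b s t : shift2 p a b s t 0 ord0 =
  cmap c p 0 ord0 + s * (a == ord0)%:R + t * (b == ord0)%:R.
Proof. by rewrite !mxE eqxx /= ![ord0 == _]eq_sym. Qed.

Lemma near_quadrant p a b : cdom c p ->
  \forall st \near nbhs ((0 : R), (0 : R)), 0 <= st.1 -> 0 <= st.2 ->
    cimg c (shift2 p a b st.1 st.2).
Proof.
move=> hp; have H0 : \forall st \near nbhs ((0 : R), (0 : R)),
    cmap c p 0 ord0 <= shift2 p a b st.1 st.2 0 ord0 ->
    cimg c (shift2 p a b st.1 st.2) := @shift2_cvg p a b _ (near_cimg hp).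
apply: filterS H0 => -[s t] /= H s0 t0; apply: H.
by rewrite shift20 -addrA lerDl addr_ge0 // mulr_ge0.
Qed.

Lemma increments_filter a p : Filter (increments c a p).
Proof. exact: within_filter. Qed.

Lemma incrementsE a p (P : set R) : increments c a p P <->
  \forall h \near nbhs (0 : R), h != 0 -> cimg c (coord_shift c p a h) -> P h.
Proof. by []. Qed.

(** Positive increments are admissible in every coordinate direction, the
    transverse one included. Hence the filter of increments is proper and
    derivatives are unique, also on the boundary. *)
Lemma at_right_increments a p : cdom c p -> 0^'+ --> increments c a p.
Proof.
move=> hp P /incrementsE HP.
have HQ : \forall h \near nbhs (0 : R), 0 <= h -> cimg c (coord_shift c p a h).
  have H0 : \forall h \near (0 : R), cmap c p 0 ord0 <= coord_shift c p a h 0 ord0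
    -> cimg c (coord_shift c p a h) := @shift_cvg p a _ (near_cimg hp).
  by apply: filterS H0 => h H h0; apply: H; rewrite coord_shift0 lerDl mulr_ge0.
have H : \forall h \near nbhs (0 : R), 0 < h -> P h.
  apply: filterS2 HP HQ => h HP HQ h0.
  by apply: HP; [rewrite gt_eqF | apply: HQ; exact: ltW].
exact: H.
Qed.

Lemma increments_proper a p : cdom c p -> ProperFilter (increments c a p).
Proof.
move=> hp; apply: Build_ProperFilter_ex => P /(at_right_increments hp) HP.
by have [h Ph] := @filter_ex _ _ (at_right_proper_filter (0 : R)) _ HP; exists h.
Qed.

Lemma cinv_increments a p : cdom c p ->
  cinv c (coord_shift c p a h) @[h --> increments c a p] --> p.
Proof.
move=> hp P /(cinv_cvg hp); rewrite /within /= => HP.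
have H0 : \forall h \near (0 : R), cimg c (coord_shift c p a h) ->
  P (cinv c (coord_shift c p a h)) := @shift_cvg p a _ HP.
by apply/incrementsE; apply: filterS H0 => h H _ /H.
Qed.

End ChartPoints.

(** * Calculus of partial derivatives *)

Section PartialDerivatives.
Context (R : realType) (X : topologicalType) (c : chart R X).
Context (U : set X) (Uo : open U) (Uc : U `<=` cdom c).
Implicit Types (f g : X -> R) (a b : 'I_6) (p q : X).

Lemma near_increments a p : U p ->
  \forall h \near increments c a p, U (cinv c (coord_shift c p a h)).
Proof.
move=> hp; apply: (cinv_increments a (Uc hp)).
by apply: open_nbhs_nbhs; split.
Qed.

(** Wrapped in a record because the convergence statement unfolds to a product,
    which would corrupt the implicit arguments of the lemmas about it. *)
Record is_pd a f p (l : R) : Prop :=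
  IsPd { is_pd_cvg : diffquo c a f p @ increments c a p --> l }.

Lemma is_pd_unique a f p l : U p -> is_pd a f p l -> pd c a f p = l.
Proof.
move=> hp [H]; have := increments_proper a (Uc hp) => FF.
exact: cvg_lim.
Qed.

(** Derivatives at a point of the open set [U] only see values on [U]: this lets
    the tensors, which are total functions, be replaced by formulas that hold on
    [U] only. *)
Lemma diffquo_eq a f g p : U p -> (forall q, U q -> f q = g q) ->
  diffquo c a f p @ increments c a p = diffquo c a g p @ increments c a p.
Proof.
move=> hp E; have FF := increments_filter c a p.
have H := near_increments a hp.
have {E}H : \forall h \near increments c a p, diffquo c a f p h = diffquo c a g p h.
  by apply: filterS H => h Uh; rewrite /diffquo !E.
apply/funext => P; apply/propext; split; apply: filterS2 H => h /= -> //.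
Qed.

Lemma pd_eq a f g p : U p -> (forall q, U q -> f q = g q) ->
  pd c a f p = pd c a g p.
Proof. by move=> hp E; rewrite /pd (diffquo_eq a hp E). Qed.

Lemma within_increments a f p : U p -> {within U, continuous f} ->
  f (cinv c (coord_shift c p a h)) @[h --> increments c a p] --> f p.
Proof.
move=> hp; rewrite continuous_open_subspace // => /(_ p (mem_set hp)) fc.
exact: cvg_comp (cinv_increments a (Uc hp)) fc.
Qed.

Lemma is_pd_cst a (k : R) p : U p -> is_pd a (fun=> k) p 0.
Proof.
move=> hp; have FF := increments_filter c a p.
split; rewrite (_ : diffquo c a _ p = fun=> 0); first exact: cvg_cst.
by apply/funext => h; rewrite /diffquo subrr mulr0.
Qed.

Lemma is_pdD a f g p l m : is_pd a f p l -> is_pd a g p m ->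
  is_pd a (fun q => f q + g q) p (l + m).
Proof.
move=> [Hf] [Hg]; have FF := increments_filter c a p.
split; rewrite (_ : diffquo c a _ p =
  fun h => diffquo c a f p h + diffquo c a g p h); first exact: cvgD.
by apply/funext => h; rewrite /diffquo; ring.
Qed.

Lemma is_pdM a f g p l m : U p -> {within U, continuous g} ->
  is_pd a f p l -> is_pd a g p m ->
  is_pd a (fun q => f q * g q) p (l * g p + f p * m).
Proof.
move=> hp gc [Hf] [Hg]; have FF := increments_filter c a p.
split; rewrite (_ : diffquo c a _ p = fun h => diffquo c a f p h *
    g (cinv c (coord_shift c p a h)) + f p * diffquo c a g p h).
  apply: cvgD; first by apply: cvgM => //; exact: within_increments.
  by apply: cvgM => //; exact: cvg_cst.
by apply/funext => h; rewrite /diffquo; ring.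
Qed.

Lemma is_pdV a f p l : (forall q, U q -> f q != 0) ->
  U p -> {within U, continuous f} -> is_pd a f p l ->
  is_pd a (fun q => (f q)^-1) p (- l * ((f p)^-1 * (f p)^-1)).
Proof.
move=> f0 hp fc [Hf]; have FF := increments_filter c a p.
have H : (fun h => - diffquo c a f p h *
    ((f (cinv c (coord_shift c p a h)))^-1 * (f p)^-1)) @ increments c a p -->
    - l * ((f p)^-1 * (f p)^-1).
  apply: cvgM; first exact: cvgN.
  apply: cvgM; last exact: cvg_cst.
  by apply: cvgV; [exact: f0 | exact: within_increments].
split; move: H; apply: cvg_trans; apply: near_eq_cvg.
apply: filterS (near_increments a hp) => h Uh; rewrite /diffquo.
(* the identity also holds for h = 0, where h^-1 = 0 *)
by move: (h^-1) => k; field; rewrite (f0 _ hp) (f0 _ Uh).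
Qed.

Lemma Ck_cts k f : Ck c k U f -> {within U, continuous f}.
Proof. by case: k => [|k] []. Qed.

Lemma Ck_is_pd k a f p : Ck c k.+1 U f -> U p -> is_pd a f p (pd c a f p).
Proof. by move=> [_ H] hp; have [/(_ p hp)] := H a. Qed.

Lemma Ck_pd k a f : Ck c k.+1 U f -> Ck c k U (pd c a f).
Proof. by move=> [_ H]; have [] := H a. Qed.

Lemma Ck_build k f (df : 'I_6 -> X -> R) : {within U, continuous f} ->
  (forall a p, U p -> is_pd a f p (df a p)) ->
  (forall a, Ck c k U (pd c a f)) -> Ck c k.+1 U f.
Proof.
move=> fc fd Hk; split=> // a; split=> [p hp|]; last exact: Hk.
by apply/cvg_ex; exists (df a p); exact: (is_pd_cvg (fd _ _ _)).
Qed.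

Lemma Ck_eq k f g : (forall q, U q -> f q = g q) -> Ck c k U f -> Ck c k U g.
Proof.
elim: k f g => [|k IH] f g E [fc H].
  split=> //; apply: subspace_eq_continuous fc => q /set_mem; exact: E.
split; first by apply: subspace_eq_continuous fc => q /set_mem; exact: E.
move=> a; have [H1 H2] := H a; split.
  by move=> p hp; rewrite -(diffquo_eq a hp E); exact: H1.
by apply: IH H2 => q hq; exact: pd_eq.
Qed.

Lemma CkW k f : Ck c k.+1 U f -> Ck c k U f.
Proof.
elim: k f => [|k IH] f [fc H]; split => // a; have [H1 H2] := H a.
by split=> //; exact: IH.
Qed.

Lemma Ck_cst k (r : R) : Ck c k U (fun=> r).
Proof.
elim: k r => [|k IH] r; first by split=> //; apply: continuous_subspaceT => ? ?;
  exact: cvg_cst.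
apply: (@Ck_build _ _ (fun _ _ => 0)).
- by apply: continuous_subspaceT => ?; exact: cvg_cst.
- by move=> a p hp; exact: is_pd_cst.
- move=> a; apply: (@Ck_eq _ (fun=> 0)) => // q hq.
  by rewrite (is_pd_unique hq (is_pd_cst _ _ hq)).
Qed.

Lemma withinD f g : {within U, continuous f} -> {within U, continuous g} ->
  {within U, continuous (fun q => f q + g q)}.
Proof.
move=> /subspace_continuousP fc /subspace_continuousP gc.
by apply/subspace_continuousP => q hq; apply: cvgD; [exact: fc | exact: gc].
Qed.

Lemma withinM f g : {within U, continuous f} -> {within U, continuous g} ->
  {within U, continuous (fun q => f q * g q)}.
Proof.
move=> /subspace_continuousP fc /subspace_continuousP gc.
by apply/subspace_continuousP => q hq; apply: cvgM; [exact: fc | exact: gc].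
Qed.

Lemma CkD k f g : Ck c k U f -> Ck c k U g -> Ck c k U (fun q => f q + g q).
Proof.
elim: k f g => [|k IH] f g Hf Hg.
  by split=> //; apply: withinD; [exact: (Ck_cts Hf) | exact: (Ck_cts Hg)].
apply: (@Ck_build _ _ (fun a p => pd c a f p + pd c a g p)).
- by apply: withinD; [exact: (Ck_cts Hf) | exact: (Ck_cts Hg)].
- by move=> a p hp; exact: is_pdD (Ck_is_pd a Hf hp) (Ck_is_pd a Hg hp).
- move=> a; apply: (@Ck_eq _ (fun p => pd c a f p + pd c a g p)) => [q hq|].
    by rewrite (is_pd_unique hq (is_pdD (Ck_is_pd a Hf hq) (Ck_is_pd a Hg hq))).
  by apply: IH; exact: Ck_pd.
Qed.

Lemma CkM k f g : Ck c k U f -> Ck c k U g -> Ck c k U (fun q => f q * g q).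
Proof.
elim: k f g => [|k IH] f g Hf Hg.
  by split=> //; apply: withinM; [exact: (Ck_cts Hf) | exact: (Ck_cts Hg)].
have fc := Ck_cts Hf; have gc := Ck_cts Hg.
apply: (@Ck_build _ _ (fun a p => pd c a f p * g p + f p * pd c a g p)).
- exact: withinM.
- by move=> a p hp; exact: is_pdM hp gc (Ck_is_pd a Hf hp) (Ck_is_pd a Hg hp).
- move=> a; apply: (@Ck_eq _ (fun p => pd c a f p * g p + f p * pd c a g p)).
    move=> q hq.
    by rewrite (is_pd_unique hq (is_pdM hq gc (Ck_is_pd a Hf hq) (Ck_is_pd a Hg hq))).
  by apply: CkD; apply: IH; solve [exact: Ck_pd | exact: CkW].
Qed.

Lemma CkV k f : (forall q, U q -> f q != 0) ->
  Ck c k U f -> Ck c k U (fun q => (f q)^-1).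
Proof.
move=> f0; elim: k => [|k IH] Hf; have fc := Ck_cts Hf.
  split=> //; apply/subspace_continuousP => q hq; apply: cvgV; first exact: f0.
  by move/subspace_continuousP: fc; apply.
apply: (@Ck_build _ _ (fun a p => - pd c a f p * ((f p)^-1 * (f p)^-1))).
- apply/subspace_continuousP => q hq; apply: cvgV; first exact: f0.
  by move/subspace_continuousP: fc; apply.
- by move=> a p hp; exact: is_pdV f0 hp fc (Ck_is_pd a Hf hp).
- move=> a; apply: (@Ck_eq _ (fun p => (-1) * pd c a f p * ((f p)^-1 * (f p)^-1))).
    move=> q hq.
    by rewrite (is_pd_unique hq (is_pdV f0 hq fc (Ck_is_pd a Hf hq))) mulN1r.
  have HV := IH (CkW Hf).
  by apply: CkM; apply: CkM => //; [exact: Ck_cst | exact: Ck_pd].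
Qed.

End PartialDerivatives.

(** * Symmetry of second derivatives up to the boundary *)

(** Two applications of the mean value theorem, first in [s] to the difference of
    [phi] in [t], then in [t]. *)
Lemma mixed_difference (R : realType) (phi dphi ddphi : R -> R -> R) (e h : R) :
  0 < h < e ->
  (forall s t : R, 0 < s < e -> 0 <= t < e ->
    is_derive s 1 (phi^~ t) (dphi s t)) ->
  (forall s t : R, 0 < s < e -> 0 < t < e -> is_derive t 1 (dphi s) (ddphi s t)) ->
  (forall t : R, 0 <= t < e -> {within `[0, h], continuous (phi^~ t)}) ->
  (forall s : R, 0 < s < e -> {within `[0, h], continuous (dphi s)}) ->
  exists s t, [/\ 0 < s < h, 0 < t < h &
    phi h h - phi 0 h - (phi h 0 - phi 0 0) = ddphi s t * h * h].
Proof.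
move=> /andP[h0 he] D1 D2 C1 C2.
have e0 : 0 < e by exact: lt_trans he.
have hh : 0 <= h < e by rewrite ltW.
have z0 : (0 : R) <= 0 < e by rewrite lexx.
have [||s + sE] := @MVT R (fun s => phi s h - phi s 0)
    (fun s => dphi s h - dphi s 0) 0 h h0.
- move=> s; rewrite in_itv /= => /andP[s0 sh].
  have se : 0 < s < e by rewrite s0 (lt_trans sh).
  have A := D1 _ _ se hh; have B := D1 _ _ se z0.
  exact: is_deriveB.
- have /subspace_continuousP A := C1 _ hh; have /subspace_continuousP B := C1 _ z0.
  by apply/subspace_continuousP => s sI; apply: cvgB; [exact: A | exact: B].
rewrite in_itv /= => /andP[s0 sh].
have se : 0 < s < e by rewrite s0 (lt_trans sh).
have D t : t \in `]0, h[%R -> is_derive t 1 (dphi s) (ddphi s t).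
  rewrite in_itv /= => /andP[t0 th].
  by apply: D2 => //; rewrite t0 (lt_trans th).
have [t + tE] := MVT h0 D (C2 _ se).
rewrite in_itv /= => /andP[t0 th].
exists s, t; split; rewrite ?s0 ?t0 //.
have -> : phi h h - phi 0 h - (phi h 0 - phi 0 0) =
  (phi h h - phi h 0) - (phi 0 h - phi 0 0) by ring.
by rewrite sE tE !subr0.
Qed.

(** Both orders of differentiation evaluate the same mixed difference over the
    square of side [h], so the two mixed derivatives agree at some pair of points
    of that square; letting [h] tend to [0] identifies their limits at the corner.
    Only the quadrant of nonnegative increments is used, which fits in the image
    of a chart also at a boundary point. *)
Lemma mixed_partials_quadrant (R : realType)
    (phi phi1 phi2 phi12 phi21 : R -> R -> R) (e : R) : 0 < e ->
  (forall s t : R, 0 < s < e -> 0 <= t < e -> is_derive s 1 (phi^~ t) (phi1 s t)) ->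
  (forall s t : R, 0 <= s < e -> 0 < t < e -> is_derive t 1 (phi s) (phi2 s t)) ->
  (forall s t : R, 0 < s < e -> 0 < t < e -> is_derive t 1 (phi1 s) (phi12 s t)) ->
  (forall s t : R, 0 < s < e -> 0 < t < e -> is_derive s 1 (phi2^~ t) (phi21 s t)) ->
  (forall t h : R, 0 <= t < e -> h < e -> {within `[0, h], continuous (phi^~ t)}) ->
  (forall s h : R, 0 <= s < e -> h < e -> {within `[0, h], continuous (phi s)}) ->
  (forall s h : R, 0 < s < e -> h < e -> {within `[0, h], continuous (phi1 s)}) ->
  (forall t h : R, 0 < t < e -> h < e -> {within `[0, h], continuous (phi2^~ t)}) ->
  forall L1 L2 : R,
  (forall d, 0 < d -> exists2 r : R, 0 < r & forall s t : R, 0 <= s < e ->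
    0 <= t < e -> s < r -> t < r -> `|phi12 s t - L1| < d) ->
  (forall d, 0 < d -> exists2 r : R, 0 < r & forall s t : R, 0 <= s < e ->
    0 <= t < e -> s < r -> t < r -> `|phi21 s t - L2| < d) ->
  L1 = L2.
Proof.
move=> e0 D1 D2 D12 D21 C1 C2 C12 C21 L1 L2 lim1 lim2.
apply/eqP/negP => /negP ne.
have d0 : 0 < `|L1 - L2| / 2 by rewrite divr_gt0 // normr_gt0 subr_eq0.
have [r1 r10 {}lim1] := lim1 _ d0; have [r2 r20 {}lim2] := lim2 _ d0.
pose m := Num.min e (Num.min r1 r2).
have m0 : 0 < m by rewrite !lt_min e0 r10 r20.
have [me m1 m2] : [/\ m <= e, m <= r1 & m <= r2].
  by rewrite /m !ge_min !lexx ?orbT.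
have [h h0 hm] : exists2 h, 0 < h & h < m.
  by exists (m / 2); rewrite ?divr_gt0 // ltr_pdivrMr // mulr_natr mulr2n ltrDl.
have [he h1 h2] : [/\ h < e, h < r1 & h < r2].
  by split; exact: lt_le_trans hm _.
have hh : 0 < h < e by rewrite h0.
have [s [t [/andP[s0 sh] /andP[t0 th] E1]]] := mixed_difference hh D1 D12
  (fun t ht => C1 t h ht he) (fun s hs => C12 s h hs he).
have [t' [s' [/andP[t'0 t'h] /andP[s'0 s'h] E2]]] := @mixed_difference R
  (fun t s => phi s t) (fun t s => phi2 s t) (fun t s => phi21 s t) e h hh
  (fun t s ht hs => D2 s t hs ht) (fun t s ht hs => D21 s t hs ht)
  (fun s hs => C2 s h hs he) (fun t ht => C21 t h ht he).
have E : phi12 s t = phi21 s' t'.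
  have hn : h != 0 by rewrite gt_eqF.
  by apply: (mulIf hn); apply: (mulIf hn); rewrite -E1 -E2; ring.
have {}lim1 : `|phi12 s t - L1| < `|L1 - L2| / 2.
  apply: lim1; rewrite ?ltW //= ?(lt_trans sh) ?(lt_trans th) //.
have {}lim2 : `|phi21 s' t' - L2| < `|L1 - L2| / 2.
  apply: lim2; rewrite ?ltW //= ?(lt_trans s'h) ?(lt_trans t'h) //.
have : `|L1 - L2| <= `|phi12 s t - L1| + `|phi21 s' t' - L2|.
  rewrite -[L1 - L2]opprK normrN opprB E.
  have -> : L2 - L1 = (phi21 s' t' - L1) - (phi21 s' t' - L2) by ring.
  exact: ler_normB.
by move: (`|L1 - L2|) lim1 lim2 => x; clear; lra.
Qed.

Section Schwarz.
Context (R : realType) (X : topologicalType) (c : chart R X).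
Context (U : set X) (Uo : open U) (Uc : U `<=` cdom c).
Implicit Types (f g : X -> R) (a b : 'I_6) (p q : X).

Lemma quadrant p a b : U p -> exists2 e : R, 0 < e &
  forall s t, 0 <= s < e -> 0 <= t < e ->
    cimg c (shift2 c p a b s t) /\ U (cinv c (shift2 c p a b s t)).
Proof.
move=> hp.
have H1 : \forall st \near nbhs ((0 : R), (0 : R)),
    cimg c (shift2 c p a b st.1 st.2) -> U (cinv c (shift2 c p a b st.1 st.2)).
  have Un : nbhs p U by apply: open_nbhs_nbhs.
  exact: (@shift2_cvg _ _ c p a b _ (@cinv_cvg _ _ c p (Uc hp) _ Un)).
have HI : nbhs ((0 : R), (0 : R)) [set st | 0 <= st.1 -> 0 <= st.2 ->
    cimg c (shift2 c p a b st.1 st.2) /\ U (cinv c (shift2 c p a b st.1 st.2))].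
  apply: filterS2 (near_quadrant a b (Uc hp)) H1 => st A B s0 t0.
  by have C := A s0 t0; split=> //; exact: B.
have [e /= e0 He] := (nbhs_ballP _ _).1 HI.
exists e => // s t /andP[s0 se] /andP[t0 te].
have st : ball ((0 : R), (0 : R)) e (s, t).
  by split; rewrite /= /ball /= sub0r normrN ger0_norm.
exact: He (s, t) st s0 t0.
Qed.

Lemma shift2C p a b s t : shift2 c p a b s t = shift2 c p b a t s.
Proof. by rewrite /shift2 addrAC. Qed.

Lemma quadrant_cvg p a b g (e s t : R) :
  {within U, continuous g} -> 0 < e ->
  (forall s t : R, 0 <= s < e -> 0 <= t < e ->
    cimg c (shift2 c p a b s t) /\ U (cinv c (shift2 c p a b s t))) ->
  0 <= s < e -> 0 <= t < e -> forall d : R, 0 < d ->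
  exists2 r : R, 0 < r & forall s' t', `|s' - s| < r -> `|t' - t| < r ->
    0 <= s' < e -> 0 <= t' < e ->
    `|g (cinv c (shift2 c p a b s' t')) - g (cinv c (shift2 c p a b s t))| < d.
Proof.
move=> gc e0 He hs ht d d0; have [yc yU] := He _ _ hs ht.
set y := shift2 c p a b s t in yc yU *.
have [yK qc] := cimg_cinv yc.
move: gc; rewrite continuous_open_subspace // => /(_ _ (mem_set yU)) gc.
have H1 : nbhs (cinv c y) [set q | `|g q - g (cinv c y)| < d].
  have B : nbhs (g (cinv c y)) [set r | `|r - g (cinv c y)| < d].
    have := @nbhsx_ballx _ R (g (cinv c y)) _ d0.
    by apply: filterS => r; rewrite /= /ball /= distrC.
  exact: gc _ B.
have H2 := @cinv_cvg _ _ c _ qc _ H1.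
have S : (fun st : R * R => shift2 c p a b st.1 st.2) @ (s, t) --> cmap c (cinv c y).
  rewrite yK; apply: cvgD; first apply: cvgD; first exact: cvg_cst.
  - by apply: cvgZr_tmp; exact: cvg_fst.
  - by apply: cvgZr_tmp; exact: cvg_snd.
have H3 : \forall st \near nbhs (s, t), cimg c (shift2 c p a b st.1 st.2) ->
  `|g (cinv c (shift2 c p a b st.1 st.2)) - g (cinv c y)| < d := S _ H2.
have [r /= r0 Hr] := (nbhs_ballP _ _).1 H3.
exists r => // s' t' s'r t'r A B; have st : ball (s, t) r (s', t').
  by split; rewrite /= /ball /= distrC.
by apply: (Hr _ st) => /=; have [] := He _ _ A B.
Qed.

(** At a point with positive [a]-increment small increments of both signs are
    admissible, so the restricted derivative is the ordinary one. *)
Lemma quadrant_derive p a b g (e s t : R) : Ck c 1 U g ->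
  (forall s t : R, 0 <= s < e -> 0 <= t < e ->
    cimg c (shift2 c p a b s t) /\ U (cinv c (shift2 c p a b s t))) ->
  0 < s < e -> 0 <= t < e ->
  is_derive s 1 (fun s => g (cinv c (shift2 c p a b s t)))
    (pd c a g (cinv c (shift2 c p a b s t))).
Proof.
move=> gC He /andP[s0 se] ht.
have [yc yU] : cimg c (shift2 c p a b s t) /\ U (cinv c (shift2 c p a b s t)).
  by apply: He => //; rewrite se ltW.
have [yK qc] := cimg_cinv yc.
set q := cinv c _ in yK qc yU *.
have [H] := Ck_is_pd a gC yU.
have E h : coord_shift c q a h = shift2 c p a b (s + h) t.
  by rewrite /coord_shift yK /shift2 scalerDl addrA -!addrA [X in _ + (_ + X)]addrC.
have {}H : (fun h => h^-1 *: (g (cinv c (shift2 c p a b (h *: 1 + s) t)) -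
    g (cinv c (shift2 c p a b s t)))) @ 0^' --> pd c a g q.
  (* 0^' refines the filter of increments, since cimg contains all small shifts *)
  apply: (cvg_trans _ H) => P /incrementsE HP.
  have S : \forall h \near nbhs (0 : R), cimg c (coord_shift c q a h).
    have : \forall h \near nbhs (0 : R), `|h| < Num.min s (e - s).
      have m0 : 0 < Num.min s (e - s) by rewrite lt_min s0 subr_gt0.
      by have := nbhsx_ballx (0 : R) _ m0; apply: filterS => h;
        rewrite /ball /= sub0r normrN.
    apply: filterS => h; rewrite lt_min !ltr_norml => /andP[/andP[h1 h2] /andP[h3 h4]].
    by rewrite E; apply: (He _ _ _ ht).1; apply/andP; split; lra.
  have : \forall h \near nbhs (0 : R), h != 0 ->
      P (h^-1 *: (g (cinv c (shift2 c p a b (h *: 1 + s) t)) -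
        g (cinv c (shift2 c p a b s t)))).
    apply: filterS2 HP S => h HP Sh h0; have Sh' := Sh; rewrite E in Sh'.
    have := HP h0; rewrite /= /diffquo E => /(_ Sh'); rewrite /q /= /GRing.scale /= mulr1.
    by rewrite [h + s]addrC.
  by [].
by split; [apply/cvg_ex; exists (pd c a g q) | exact: cvg_lim].
Qed.

Theorem pd_comm a b f p : U p -> Ck c 2 U f ->
  pd c b (pd c a f) p = pd c a (pd c b f) p.
Proof.
move=> hp fC; have [e e0 He] := quadrant a b hp.
have He' s t : 0 <= s < e -> 0 <= t < e ->
    cimg c (shift2 c p b a s t) /\ U (cinv c (shift2 c p b a s t)).
  by move=> hs ht; rewrite shift2C; exact: He.
have fC1 := CkW fC; have faC := Ck_pd a fC; have fbC := Ck_pd b fC.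
have fc := Ck_cts fC.
have fac := Ck_cts faC; have fbc := Ck_cts fbC.
have fabc := Ck_cts (Ck_pd b faC); have fbac := Ck_cts (Ck_pd a fbC).
have z0 : (0 : R) <= 0 < e by rewrite lexx.
have P0 : cinv c (shift2 c p a b 0 0) = p.
  by rewrite /shift2 !scale0r !addr0 cinv_cmap //; exact: Uc.
pose phi g s t := g (cinv c (shift2 c p a b s t)) : R.
have Cs g h t : {within U, continuous g} -> h < e -> 0 <= t < e ->
    {within `[0, h], continuous (fun s => phi g s t)}.
  move=> gc he ht; apply/subspace_continuousP => s /=; rewrite in_itv /= => sI.
  have hs : 0 <= s < e by case/andP: sI => -> /le_lt_trans ->.
  apply/cvgrPdist_lt => d d0.
  have [r r0 Hr] := quadrant_cvg gc e0 He hs ht d0.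
  apply/nbhs_ballP; exists r => //= s'; rewrite /ball /= => s'r.
  rewrite in_itv /= => /andP[s'0 s'h]; rewrite distrC.
  by apply: Hr; rewrite ?subrr ?normr0 1?distrC // s'0 (le_lt_trans s'h).
have Ct g h s : {within U, continuous g} -> h < e -> 0 <= s < e ->
    {within `[0, h], continuous (phi g s)}.
  move=> gc he hs; apply/subspace_continuousP => t /=; rewrite in_itv /= => tI.
  have ht : 0 <= t < e by case/andP: tI => -> /le_lt_trans ->.
  apply/cvgrPdist_lt => d d0.
  have [r r0 Hr] := quadrant_cvg gc e0 He hs ht d0.
  apply/nbhs_ballP; exists r => //= t'; rewrite /ball /= => t'r.
  rewrite in_itv /= => /andP[t'0 t'h]; rewrite distrC.
  by apply: Hr; rewrite ?subrr ?normr0 1?distrC // t'0 (le_lt_trans t'h).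
have pos_nneg (s : R) : 0 < s < e -> 0 <= s < e by move=> /andP[s0 ->]; rewrite ltW.
have Da g : Ck c 1 U g -> forall s t, 0 < s < e -> 0 <= t < e ->
    is_derive s 1 (fun s => phi g s t) (phi (pd c a g) s t).
  by move=> gC s t hs ht; exact: (quadrant_derive gC He hs ht).
have Db g : Ck c 1 U g -> forall t s, 0 < t < e -> 0 <= s < e ->
    is_derive t 1 (phi g s) (phi (pd c b g) s t).
  move=> gC t s ht hs.
  have Eq k : phi k s = fun t => k (cinv c (shift2 c p b a t s)).
    by apply/funext => t'; rewrite /phi shift2C.
  by rewrite !Eq; exact: (quadrant_derive gC He' ht hs).
have Lim g : {within U, continuous g} -> forall d, 0 < d -> exists2 r : R, 0 < r &
    forall s t : R, 0 <= s < e -> 0 <= t < e -> s < r -> t < r ->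
    `|phi g s t - g p| < d.
  move=> gc d d0; have [r r0 Hr] := quadrant_cvg gc e0 He z0 z0 d0.
  rewrite P0 in Hr; exists r => // s t hs ht sr tr; apply: Hr => //.
  - by case/andP: hs => s0 _; rewrite subr0 ger0_norm.
  - by case/andP: ht => t0 _; rewrite subr0 ger0_norm.
exact (@mixed_partials_quadrant R (phi f) (phi (pd c a f)) (phi (pd c b f))
  (phi (pd c b (pd c a f))) (phi (pd c a (pd c b f))) e e0 (Da f fC1)
  (fun s t hs ht => Db f fC1 t s ht hs) (fun s t hs ht => Db _ faC t s ht (pos_nneg _ hs))
  (fun s t hs ht => Da _ fbC s t hs (pos_nneg _ ht))
  (fun t h ht he => Cs f h t fc he ht) (fun s h hs he => Ct f h s fc he hs)
  (fun s h hs he => Ct _ h s fac he (pos_nneg _ hs))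
  (fun t h ht he => Cs _ h t fbc he (pos_nneg _ ht)) _ _ (Lim _ fabc) (Lim _ fbac)).
Qed.

End Schwarz.

(** * Smooth real and K-valued functions *)

Section SmoothFunctions.
Context (R : realType) (X : topologicalType) (c : chart R X).
Context (U : set X) (Uo : open U) (Uc : U `<=` cdom c).
Implicit Types (f g : X -> R) (a b : 'I_6) (p q : X).

Lemma smooth_eq f g : (forall q, U q -> f q = g q) ->
  smooth c U f -> smooth c U g.
Proof. by move=> E H k; exact: (Ck_eq Uo Uc E (H k)). Qed.

Lemma smooth_cst (r : R) : smooth c U (fun=> r).
Proof. by move=> k; exact: Ck_cst. Qed.

Lemma smoothD f g : smooth c U f -> smooth c U g -> smooth c U (fun q => f q + g q).
Proof. by move=> Hf Hg k; exact: CkD. Qed.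

Lemma smoothMul f g : smooth c U f -> smooth c U g -> smooth c U (fun q => f q * g q).
Proof. by move=> Hf Hg k; exact: CkM. Qed.

Lemma smoothV f : (forall q, U q -> f q != 0) -> smooth c U f ->
  smooth c U (fun q => (f q)^-1).
Proof. by move=> f0 Hf k; exact: CkV. Qed.

Lemma smooth_pd a f : smooth c U f -> smooth c U (pd c a f).
Proof. by move=> Hf k; exact: Ck_pd (Hf k.+1). Qed.

Lemma smooth_sum (I : Type) (r : seq I) (P : pred I) (F : I -> X -> R) :
  (forall i, smooth c U (F i)) -> smooth c U (fun q => \sum_(i <- r | P i) F i q).
Proof.
move=> H; elim: r => [|i r IH].
  by apply: (smooth_eq _ (smooth_cst 0)) => q _; rewrite big_nil.
case E : (P i); last by apply: (smooth_eq _ IH) => q _; rewrite big_cons E.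
by apply: (smooth_eq _ (smoothD (H i) IH)) => q _; rewrite big_cons E.
Qed.

Lemma smooth_prod (I : Type) (r : seq I) (P : pred I) (F : I -> X -> R) :
  (forall i, smooth c U (F i)) -> smooth c U (fun q => \prod_(i <- r | P i) F i q).
Proof.
move=> H; elim: r => [|i r IH].
  by apply: (smooth_eq _ (smooth_cst 1)) => q _; rewrite big_nil.
case E : (P i); last by apply: (smooth_eq _ IH) => q _; rewrite big_cons E.
by apply: (smooth_eq _ (smoothMul (H i) IH)) => q _; rewrite big_cons E.
Qed.

Lemma smooth_is_pd a f p : smooth c U f -> U p -> is_pd c a f p (pd c a f p).
Proof. by move=> H; exact: Ck_is_pd (H 1%N). Qed.

Lemma smooth_cts f : smooth c U f -> {within U, continuous f}.
Proof. by move=> H; exact: Ck_cts (H 0%N). Qed.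

Lemma pd_cst a (r : R) p : U p -> pd c a (fun=> r) p = 0.
Proof. by move=> hp; rewrite (is_pd_unique Uc hp (is_pd_cst c a r hp)). Qed.

Lemma pdD a f g p : smooth c U f -> smooth c U g -> U p ->
  pd c a (fun q => f q + g q) p = pd c a f p + pd c a g p.
Proof.
move=> Hf Hg hp.
by rewrite (is_pd_unique Uc hp (is_pdD (smooth_is_pd a Hf hp) (smooth_is_pd a Hg hp))).
Qed.

Lemma pdMul a f g p : smooth c U f -> smooth c U g -> U p ->
  pd c a (fun q => f q * g q) p = pd c a f p * g p + f p * pd c a g p.
Proof.
move=> Hf Hg hp; exact: (is_pd_unique Uc hp (is_pdM Uo Uc hp (smooth_cts Hg)
  (smooth_is_pd a Hf hp) (smooth_is_pd a Hg hp))).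
Qed.

Lemma pd_sum a (I : Type) (r : seq I) (P : pred I) (F : I -> X -> R) p :
  (forall i, smooth c U (F i)) -> U p ->
  pd c a (fun q => \sum_(i <- r | P i) F i q) p = \sum_(i <- r | P i) pd c a (F i) p.
Proof.
move=> H hp; elim: r => [|i r IH].
  by rewrite big_nil -[RHS](pd_cst a 0 hp); apply: (pd_eq Uo Uc a hp) => q _; rewrite big_nil.
rewrite big_cons -IH -pdD //; last exact: smooth_sum.
case E : (P i); by apply: (pd_eq Uo Uc a hp) => q _; rewrite big_cons E.
Qed.

Lemma pdMl a (k : R) f p : smooth c U f -> U p ->
  pd c a (fun q => k * f q) p = k * pd c a f p.
Proof.
by move=> Hf hp; rewrite pdMul //; [rewrite pd_cst // mul0r add0r | exact: smooth_cst].
Qed.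

Lemma pd_pdC a b f p : smooth c U f -> U p ->
  pd c a (pd c b f) p = pd c b (pd c a f) p.
Proof. by move=> Hf hp; exact: (pd_comm Uo Uc b a hp (Hf 2%N)). Qed.

End SmoothFunctions.

Lemma smooth_sub (R : realType) (X : topologicalType) (c : chart R X)
    (U V : set X) (f : X -> R) : V `<=` U -> smooth c U f -> smooth c V f.
Proof.
move=> VU H k; move: k f {H}(H k); elim=> [|k IH] f [fc H].
  by split=> //; exact: continuous_subspaceW fc.
split; first exact: continuous_subspaceW fc.
move=> a; have [H1 H2] := H a; split; last exact: IH.
by move=> p /VU; exact: H1.
Qed.

Section ScalarFunctions.
Context (R : realType) (X : topologicalType) (c : chart R X).
Context (K : fieldExtType R).
Context (U : set X) (Uo : open U) (Uc : U `<=` cdom c).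
Implicit Types (f g : X -> K) (a b : 'I_6) (p q : X).

Local Notation e := (vbasis {:K}).

(** K-valued functions are differentiated through their coordinates in a basis of
    [K] over [R]; the rules of calculus are transferred along these coordinates,
    products by the structure constants of [K]. *)
Lemma coord_inj (x y : K) : (forall k, coord e k x = coord e k y) -> x = y.
Proof.
move=> H; rewrite (coord_vbasis (memvf x)) (coord_vbasis (memvf y)).
by apply: eq_bigr => k _; rewrite H.
Qed.

Lemma coord_pdK a f p k : coord e k (pdK c a f p) = pd c a (fun q => coord e k (f q)) p.
Proof. by rewrite coord_sum_free // (basis_free (vbasisP _)). Qed.

Lemma coordM (x y : K) k : coord e k (x * y) =
  \sum_(i < \dim {:K}) \sum_(j < \dim {:K})
    coord e k (e`_i * e`_j) * (coord e i x * coord e j y).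
Proof.
rewrite [in LHS](coord_vbasis (memvf x)) [in LHS](coord_vbasis (memvf y)).
rewrite mulr_suml linear_sum; apply: eq_bigr => i _.
rewrite mulr_sumr linear_sum; apply: eq_bigr => j _.
by rewrite -scalerAl -scalerAr !linearZ /= mulrA mulrC.
Qed.

Lemma smoothK_eq f g : (forall q, U q -> f q = g q) ->
  smoothK c U f -> smoothK c U g.
Proof. by move=> E H k; apply: (smooth_eq Uo Uc _ (H k)) => q /E ->. Qed.

Lemma smoothK_cst (x : K) : smoothK c U (fun=> x).
Proof. by move=> k; exact: smooth_cst. Qed.

Lemma smoothKD f g : smoothK c U f -> smoothK c U g -> smoothK c U (fun q => f q + g q).
Proof.
move=> Hf Hg k; apply: (smooth_eq Uo Uc _ (smoothD Uo Uc (Hf k) (Hg k))) => q _.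
by rewrite linearD.
Qed.

Lemma smoothKM f g : smoothK c U f -> smoothK c U g -> smoothK c U (fun q => f q * g q).
Proof.
move=> Hf Hg k.
apply: (@smooth_eq _ _ _ _ Uo Uc (fun q =>
  \sum_(i < \dim {:K}) \sum_(j < \dim {:K}) coord e k (e`_i * e`_j) *
  (coord e i (f q) * coord e j (g q)))) => [q _|]; first by rewrite coordM.
do 2![apply: smooth_sum => // ?]; apply: smoothMul => //; first exact: smooth_cst.
exact: smoothMul.
Qed.

Lemma smoothK_alg (h : X -> R) : smooth c U h -> smoothK c U (fun q => (h q)%:A : K).
Proof.
move=> H k; apply: (smooth_eq Uo Uc _ (smoothMul Uo Uc H (smooth_cst Uo Uc (coord e k 1)))).
by move=> q _; rewrite linearZ.
Qed.

Lemma smoothK_pdK a f : smoothK c U f -> smoothK c U (pdK c a f).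
Proof.
move=> H k; apply: (smooth_eq Uo Uc _ (smooth_pd a (H k))) => q _.
by rewrite coord_pdK.
Qed.

Lemma pdK_eq a f g p : U p -> (forall q, U q -> f q = g q) -> pdK c a f p = pdK c a g p.
Proof.
move=> hp E; apply: coord_inj => k; rewrite !coord_pdK.
by apply: (pd_eq Uo Uc a hp) => q /E ->.
Qed.

Lemma pdK_cst a (x : K) p : U p -> pdK c a (fun=> x) p = 0.
Proof.
by move=> hp; apply: coord_inj => k; rewrite coord_pdK (pd_cst Uc) // linear0.
Qed.

Lemma pdKD a f g p : smoothK c U f -> smoothK c U g -> U p ->
  pdK c a (fun q => f q + g q) p = pdK c a f p + pdK c a g p.
Proof.
move=> Hf Hg hp; apply: coord_inj => k; rewrite linearD /= !coord_pdK.
by rewrite -(pdD Uc) //; apply: (pd_eq Uo Uc a hp) => q _; rewrite linearD.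
Qed.

Lemma pdKM a f g p : smoothK c U f -> smoothK c U g -> U p ->
  pdK c a (fun q => f q * g q) p = pdK c a f p * g p + f p * pdK c a g p.
Proof.
move=> Hf Hg hp; apply: coord_inj => k; rewrite linearD /= !coordM coord_pdK.
rewrite (pd_eq Uo Uc (g := fun q =>
  \sum_(i < \dim {:K}) \sum_(j < \dim {:K}) coord e k (e`_i * e`_j) *
  (coord e i (f q) * coord e j (g q))) a hp) => [|q _]; last by rewrite coordM.
have S (i j : 'I_(\dim {:K})) : smooth c U (fun q => coord e k (e`_i * e`_j) *
    (coord e i (f q) * coord e j (g q))).
  by apply: smoothMul => //; [exact: smooth_cst | exact: smoothMul].
rewrite (pd_sum Uo Uc) // => [|i]; last exact: smooth_sum.
rewrite -big_split; apply: eq_bigr => i _; rewrite (pd_sum Uo Uc) //.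
rewrite -big_split; apply: eq_bigr => j _.
rewrite (pdMl Uo Uc) //; last exact: smoothMul.
by rewrite (pdMul Uo Uc) // mulrDr !coord_pdK.
Qed.

Lemma pdK_alg a (h : X -> R) p : smooth c U h -> U p ->
  pdK c a (fun q => (h q)%:A : K) p = (pd c a h p)%:A :> K.
Proof.
move=> H hp; apply: coord_inj => k; rewrite coord_pdK linearZ /= mulrC -(pdMl Uo Uc) //.
by apply: (pd_eq Uo Uc a hp) => q _; rewrite linearZ /= mulrC.
Qed.

Lemma pdK_pdKC a b f p : smoothK c U f -> U p ->
  pdK c a (pdK c b f) p = pdK c b (pdK c a f) p.
Proof.
move=> Hf hp; apply: coord_inj => k.
have E a' b' : pd c a' (fun q => coord e k (pdK c b' f q)) p =
    pd c a' (pd c b' (fun q => coord e k (f q))) p.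
  by apply: (pd_eq Uo Uc a' hp) => q _; rewrite coord_pdK.
(* an explicit chain: unifying the two iterated derivatives would unfold them *)
by apply: etrans (coord_pdK _ _ _ _) _; rewrite E (pd_pdC Uo Uc a b (Hf k) hp) -E -coord_pdK.
Qed.

Lemma smoothK_sum (I : Type) (r : seq I) (P : pred I) (F : I -> X -> K) :
  (forall i, smoothK c U (F i)) -> smoothK c U (fun q => \sum_(i <- r | P i) F i q).
Proof.
move=> H k; apply: (@smooth_eq _ _ _ _ Uo Uc
  (fun q => \sum_(i <- r | P i) coord e k (F i q))) => [q _|].
  by rewrite linear_sum.
by apply: smooth_sum => // i; exact: H.
Qed.

Lemma pdK_sum a (I : Type) (r : seq I) (P : pred I) (F : I -> X -> K) p :
  (forall i, smoothK c U (F i)) -> U p ->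
  pdK c a (fun q => \sum_(i <- r | P i) F i q) p = \sum_(i <- r | P i) pdK c a (F i) p.
Proof.
move=> H hp; apply: coord_inj => k; rewrite [RHS]linear_sum /= coord_pdK.
have E : forall q, U q -> coord e k (\sum_(i <- r | P i) F i q) =
    \sum_(i <- r | P i) coord e k (F i q) by move=> q _; rewrite linear_sum.
rewrite (pd_eq Uo Uc a hp E) (pd_sum Uo Uc a r P (fun i => H i k) hp).
by apply: eq_bigr => i _; rewrite coord_pdK.
Qed.

End ScalarFunctions.

(** * Smooth matrix-valued functions *)

Section MatrixFunctions.
Context (R : realType) (X : topologicalType) (c : chart R X).
Context (K : fieldExtType R).
Context (U : set X) (Uo : open U) (Uc : U `<=` cdom c).
Implicit Types (a b : 'I_6) (p q : X).

Local Opaque pdK.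

Lemma smoothM_eq m n (Y Z : X -> 'M[K]_(m, n)) : (forall q, U q -> Y q = Z q) ->
  smoothM c U Y -> smoothM c U Z.
Proof. by move=> E H i j; apply: (smoothK_eq Uo Uc _ (H i j)) => q /E ->. Qed.

Lemma smoothM_cst m n (Y : 'M[K]_(m, n)) : smoothM c U (fun=> Y).
Proof. by move=> i j; exact: smoothK_cst. Qed.

Lemma smoothMD m n (Y Z : X -> 'M[K]_(m, n)) : smoothM c U Y -> smoothM c U Z ->
  smoothM c U (fun q => Y q + Z q).
Proof.
move=> HY HZ i j; apply: (smoothK_eq Uo Uc _ (smoothKD Uo Uc (HY i j) (HZ i j))).
by move=> q _; rewrite mxE.
Qed.

Lemma smoothM_mul m n l (Y : X -> 'M[K]_(m, n)) (Z : X -> 'M[K]_(n, l)) :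
  smoothM c U Y -> smoothM c U Z -> smoothM c U (fun q => Y q *m Z q).
Proof.
move=> HY HZ i j.
apply: (@smoothK_eq _ _ _ _ _ Uo Uc (fun q => \sum_k Y q i k * Z q k j)).
  by move=> q _; rewrite mxE.
apply: smoothK_sum => // k; exact: (smoothKM Uo Uc (HY i k) (HZ k j)).
Qed.

Lemma smoothM_scale m n (h : X -> K) (Y : X -> 'M[K]_(m, n)) :
  smoothK c U h -> smoothM c U Y -> smoothM c U (fun q => h q *: Y q).
Proof.
move=> Hh HY i j; apply: (smoothK_eq Uo Uc _ (smoothKM Uo Uc Hh (HY i j))).
by move=> q _; rewrite mxE.
Qed.

Lemma smoothMN m n (Y : X -> 'M[K]_(m, n)) : smoothM c U Y ->
  smoothM c U (fun q => - Y q).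
Proof.
move=> HY; apply: (smoothM_eq _ (smoothM_scale (smoothK_cst Uo Uc (-1)) HY)).
by move=> q _; rewrite scaleN1r.
Qed.

Lemma smoothMB m n (Y Z : X -> 'M[K]_(m, n)) : smoothM c U Y -> smoothM c U Z ->
  smoothM c U (fun q => Y q - Z q).
Proof. by move=> HY HZ; apply: smoothMD => //; exact: smoothMN. Qed.

Lemma smoothM_sum m n (I : Type) (r : seq I) (P : pred I) (F : I -> X -> 'M[K]_(m, n)) :
  (forall i, smoothM c U (F i)) -> smoothM c U (fun q => \sum_(i <- r | P i) F i q).
Proof.
move=> H i j; apply: (@smoothK_eq _ _ _ _ _ Uo Uc
  (fun q => \sum_(k <- r | P k) F k q i j)) => [q _|]; first by rewrite summxE.
by apply: smoothK_sum => // k; exact: H.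
Qed.

Lemma smoothM_pdM m n a (Y : X -> 'M[K]_(m, n)) : smoothM c U Y ->
  smoothM c U (pdM c a Y).
Proof.
move=> H i j; apply: (smoothK_eq Uo Uc _ (smoothK_pdK Uo Uc a (H i j))) => q _.
by rewrite mxE.
Qed.

Lemma smoothK_tr n (Y : X -> 'M[K]_n) : smoothM c U Y ->
  smoothK c U (fun q => \tr (Y q)).
Proof. by move=> H; apply: smoothK_sum => // i; exact: H. Qed.

Lemma pdM_eq m n a (Y Z : X -> 'M[K]_(m, n)) p : U p ->
  (forall q, U q -> Y q = Z q) -> pdM c a Y p = pdM c a Z p.
Proof.
move=> hp E; apply/matrixP => i j; rewrite !mxE.
by apply: (pdK_eq Uo Uc a hp) => q /E ->.
Qed.

Lemma pdM_cst m n a (Y : 'M[K]_(m, n)) p : U p -> pdM c a (fun=> Y) p = 0.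
Proof. by move=> hp; apply/matrixP => i j; rewrite !mxE (pdK_cst Uc). Qed.

Lemma pdMD m n a (Y Z : X -> 'M[K]_(m, n)) p : smoothM c U Y -> smoothM c U Z ->
  U p -> pdM c a (fun q => Y q + Z q) p = pdM c a Y p + pdM c a Z p.
Proof.
move=> HY HZ hp; apply/matrixP => i j; rewrite !mxE.
rewrite -(pdKD Uo Uc a (HY i j) (HZ i j) hp).
by apply: (pdK_eq Uo Uc a hp) => q _; rewrite mxE.
Qed.

Lemma pdM_mul m n l a (Y : X -> 'M[K]_(m, n)) (Z : X -> 'M[K]_(n, l)) p :
  smoothM c U Y -> smoothM c U Z -> U p ->
  pdM c a (fun q => Y q *m Z q) p = pdM c a Y p *m Z p + Y p *m pdM c a Z p.
Proof.
move=> HY HZ hp; apply/matrixP => i j; rewrite !mxE.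
rewrite (pdK_eq Uo Uc (g := fun q => \sum_k Y q i k * Z q k j) a hp) => [|q _]; last first.
  by rewrite mxE.
rewrite (pdK_sum Uo Uc) // => [|k]; last exact: (smoothKM Uo Uc (HY i k) (HZ k j)).
rewrite -big_split; apply: eq_bigr => k _.
by rewrite (pdKM Uo Uc a (HY i k) (HZ k j) hp) !mxE.
Qed.

Lemma pdM_scale m n a (h : X -> K) (Y : X -> 'M[K]_(m, n)) p :
  smoothK c U h -> smoothM c U Y -> U p ->
  pdM c a (fun q => h q *: Y q) p = pdK c a h p *: Y p + h p *: pdM c a Y p.
Proof.
move=> Hh HY hp; apply/matrixP => i j; rewrite !mxE.
rewrite -(pdKM Uo Uc a Hh (HY i j) hp).
by apply: (pdK_eq Uo Uc a hp) => q _; rewrite mxE.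
Qed.

Lemma pdMN m n a (Y : X -> 'M[K]_(m, n)) p : smoothM c U Y -> U p ->
  pdM c a (fun q => - Y q) p = - pdM c a Y p.
Proof.
move=> HY hp; rewrite (pdM_eq (Z := fun q => (-1) *: Y q) a hp) => [|q _].
  rewrite (pdM_scale a (smoothK_cst Uo Uc (-1)) HY hp) (pdK_cst Uc) //.
  by rewrite scale0r add0r scaleN1r.
by rewrite scaleN1r.
Qed.

Lemma pdMB m n a (Y Z : X -> 'M[K]_(m, n)) p : smoothM c U Y -> smoothM c U Z ->
  U p -> pdM c a (fun q => Y q - Z q) p = pdM c a Y p - pdM c a Z p.
Proof. by move=> HY HZ hp; rewrite pdMD ?pdMN //; exact: smoothMN. Qed.

Lemma pdM_sum m n a (I : Type) (r : seq I) (P : pred I) (F : I -> X -> 'M[K]_(m, n)) p :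
  (forall i, smoothM c U (F i)) -> U p ->
  pdM c a (fun q => \sum_(i <- r | P i) F i q) p = \sum_(i <- r | P i) pdM c a (F i) p.
Proof.
move=> H hp; apply/matrixP => i j; rewrite summxE mxE.
rewrite (pdK_eq Uo Uc (g := fun q => \sum_(k <- r | P k) F k q i j) a hp) => [|q _]; last first.
  by rewrite summxE.
rewrite (pdK_sum Uo Uc) // => [|k]; last exact: H.
by apply: eq_bigr => k _; rewrite mxE.
Qed.

Lemma pdM_pdMC m n a b (Y : X -> 'M[K]_(m, n)) p : smoothM c U Y -> U p ->
  pdM c a (pdM c b Y) p = pdM c b (pdM c a Y) p.
Proof.
move=> HY hp; apply/matrixP => i j.
have E a' b' : pdM c a' (pdM c b' Y) p i j = pdK c a' (pdK c b' (fun q => Y q i j)) p.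
  by rewrite mxE; apply: (pdK_eq Uo Uc a' hp) => q _; rewrite mxE.
exact: etrans (E _ _) (etrans (pdK_pdKC Uo Uc a b (HY i j) hp) (esym (E _ _))).
Qed.

Lemma pdK_tr n a (Y : X -> 'M[K]_n) p : smoothM c U Y -> U p ->
  pdK c a (fun q => \tr (Y q)) p = \tr (pdM c a Y p).
Proof.
move=> HY hp; rewrite (pdK_sum Uo Uc a _ _ (fun i => HY i i) hp).
by apply: eq_bigr => i _; rewrite mxE.
Qed.

End MatrixFunctions.

(** * The Levi-Civita connection in matrix form *)

Lemma addmxE (V : nmodType) m n (Y Z : 'M[V]_(m, n)) i j : (Y + Z) i j = Y i j + Z i j.
Proof. by rewrite mxE. Qed.

Lemma oppmxE (V : zmodType) m n (Y : 'M[V]_(m, n)) i j : (- Y) i j = - Y i j.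
Proof. by rewrite mxE. Qed.

Lemma pdME (R : realType) (X : topologicalType) (c : chart R X) (K : fieldExtType R)
    m n a (Y : X -> 'M[K]_(m, n)) p i j :
  pdM c a Y p i j = pdK c a (fun q => Y q i j) p.
Proof. by rewrite mxE. Qed.

Lemma pdM_tr (R : realType) (X : topologicalType) (c : chart R X) (K : fieldExtType R)
    m n a (Y : X -> 'M[K]_(m, n)) p : pdM c a (fun q => (Y q)^T) p = (pdM c a Y p)^T.
Proof.
apply/matrixP => i j; rewrite !mxE.
by congr (pdK c a _ p); apply/funext => q; rewrite mxE.
Qed.

(** Here, as in [skew_identity], [raise2_identity] or [bianchi_identity], the algebra
    of a later computation is isolated for arbitrary elements, so that unification
    compares variables instead of derivatives of functions. *)
Lemma riem_identity (R : comNzRingType) (K : lalgType R) n (x y Px Py S S' T T' : R)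
    (DP DP' G G' : 'M[K]_n) i j :
  x = Px + S - T -> y = Py + S' - T' -> T' = T ->
  DP i j = Px%:A -> DP' i j = Py%:A -> G i j = S%:A -> G' i j = S'%:A ->
  (x - y)%:A = (DP - DP' + (G - G')) i j.
Proof.
move=> -> -> -> E1 E2 E3 E4; rewrite !addmxE !oppmxE E1 E2 E3 E4.
by rewrite -!scalerBl -scalerDl; congr (_ *: _); ring.
Qed.

(** If [Hab] and [Hba] are the second derivatives of the metric, computed from
    [dG = G Gamma + (G Gamma)^T], their equality says that the lowered curvature
    [G (d_a Gamma_b - d_b Gamma_a + [Gamma_a, Gamma_b])] is skew. *)
Lemma skew_identity (K : comNzRingType) n (G Ga Gb Dab Dba Hab Hba : 'M[K]_n) : G^T = G ->
  Hab = (G *m Ga *m Gb + Ga^T *m G *m Gb + G *m Dab) +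
    (G *m Ga *m Gb + Ga^T *m G *m Gb + G *m Dab)^T ->
  Hba = (G *m Gb *m Ga + Gb^T *m G *m Ga + G *m Dba) +
    (G *m Gb *m Ga + Gb^T *m G *m Ga + G *m Dba)^T ->
  Hab = Hba ->
  (G *m (Dab - Dba + (Ga *m Gb - Gb *m Ga)))^T =
    - (G *m (Dab - Dba + (Ga *m Gb - Gb *m Ga))).
Proof.
move=> GT Eab Eba E.
have CT : (Ga^T *m G *m Gb)^T = Gb^T *m G *m Ga by rewrite !trmx_mul trmxK GT mulmxA.
have CT' : (Gb^T *m G *m Ga)^T = Ga^T *m G *m Gb by rewrite -CT trmxK.
rewrite !mulmxDr !mulmxN !mulmxA.
move: Eab; rewrite E Eba !linearD /= CT CT'.
move: (G *m Ga *m Gb) (G *m Gb *m Ga) (G *m Dab) (G *m Dba) (Ga^T *m G *m Gb)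
  (Gb^T *m G *m Ga) => A1 A2 B1 B2 C1 C2 {}E.
apply/matrixP => i j; move/esym/matrixP/(_ i j): E.
rewrite ?linearN /= !(addmxE, oppmxE) => E.
by apply/eqP; rewrite -subr_eq0; move/eqP: E; rewrite -subr_eq0 => /eqP E;
  apply/eqP; rewrite -E; ring.
Qed.

Section MetricConnection.
Context (R : realType) (X : topologicalType) (c : chart R X).
Context (K : fieldExtType R).
Context (U : set X) (Uo : open U) (Uc : U `<=` cdom c).
Context (g : X -> 'M[R]_6).
Hypothesis gS : forall a b, smooth c U (fun q => g q a b).
Hypothesis gT : forall q, U q -> (g q)^T = g q.
Hypothesis gU : forall q, U q -> g q \in unitmx.
Implicit Types (a b e f : 'I_6) (p q : X).

Local Opaque pd pdK pdM.

Lemma smooth_det n (Y : X -> 'M[R]_n) : (forall i j, smooth c U (fun q => Y q i j)) ->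
  smooth c U (fun q => \det (Y q)).
Proof.
move=> HY; apply: smooth_sum => // s.
by apply: smoothMul => //; [exact: smooth_cst | apply: smooth_prod].
Qed.

(** Cramer's rule exhibits the inverse metric as a smooth function of the metric. *)
Lemma smooth_gup a b : smooth c U (gup g a b).
Proof.
have D : smooth c U (fun q => \det (g q)) by exact: smooth_det.
have D0 q : U q -> \det (g q) != 0 by move=> /gU; rewrite unitmxE unitfE.
apply: (smooth_eq Uo Uc (f := fun q => (\det (g q))^-1 *
  ((-1) ^+ (b + a) * \det (row' b (col' a (g q)))))).
  by move=> q hq; rewrite /gup /invmx gU // !mxE.
apply: smoothMul => //; first exact: smoothV.
apply: smoothMul => //; first exact: smooth_cst.
apply: smooth_det => i j; apply: (smooth_eq Uo Uc _ (gS (lift b i) (lift a j))) => q _.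
by rewrite !mxE.
Qed.

Lemma smooth_christoffel e a b : smooth c U (christoffel c g e a b).
Proof.
rewrite /christoffel; apply: smoothMul => //; first exact: smooth_cst.
apply: smooth_sum => // f; apply: smoothMul => //; first exact: smooth_gup.
apply: (smooth_eq Uo Uc (f := fun q => pd c a (fun q => g q f b) q +
  pd c b (fun q => g q f a) q + (-1) * pd c f (fun q => g q a b) q)).
  by move=> q _; rewrite mulN1r.
apply: smoothD => //; first by apply: smoothD => //; exact: smooth_pd.
by apply: smoothMul => //; [exact: smooth_cst | exact: smooth_pd].
Qed.

Lemma metric_symE q a b : U q -> g q a b = g q b a.
Proof. by move=> hq; rewrite -[in LHS]gT // mxE. Qed.

Lemma christoffelC e a b p : U p -> christoffel c g e a b p = christoffel c g e b a p.
Proof.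
move=> hp; rewrite /christoffel; congr (_ * _); apply: eq_bigr => f _.
have E : pd c f (fun q => g q a b) p = pd c f (fun q => g q b a) p.
  by apply: (pd_eq Uo Uc f hp) => q; exact: metric_symE.
by rewrite E [X in _ * (X - _)]addrC.
Qed.

Lemma christoffel_lower f a b p : U p ->
  \sum_e g p f e * christoffel c g e a b p =
  2^-1 * (pd c a (fun q => g q f b) p + pd c b (fun q => g q f a) p
       - pd c f (fun q => g q a b) p).
Proof.
move=> hp; rewrite /christoffel.
under eq_bigr => e _ do rewrite mulrCA mulr_sumr.
rewrite -mulr_sumr exchange_big; congr (_ * _) => /=.
under eq_bigr => h _ do (under eq_bigr => e _ do rewrite mulrA);
  under eq_bigr => h _ do rewrite -mulr_suml.
rewrite (bigD1 f) //= [X in _ + X]big1 => [|h hf].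
  have -> : \sum_e g p f e * gup g e f p = (g p *m invmx (g p)) f f by rewrite mxE.
  by rewrite mulmxV ?gU // mxE eqxx mul1r addr0.
have -> : \sum_e g p f e * gup g e h p = (g p *m invmx (g p)) f h by rewrite mxE.
by rewrite mulmxV ?gU // mxE eq_sym (negPf hf) mul0r.
Qed.

Definition metricK q : 'M[K]_6 := map_mx (in_alg K) (g q).
(** The geometry is mapped to [K], where it acts on bundle-valued tensors. The
    Christoffel symbols become matrices [(gammaK a)_eb = Gamma^e_ab], the
    connection form of the tangent bundle. *)
Definition gammaK a q : 'M[K]_6 := \matrix_(e, b) (christoffel c g e a b q)%:A.

Lemma smooth_metricK : smoothM c U metricK.
Proof.
move=> i j; apply: (smoothK_eq Uo Uc _ (smoothK_alg Uo Uc (gS i j))) => q _.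
by rewrite mxE.
Qed.

Lemma smooth_gammaK a : smoothM c U (gammaK a).
Proof.
move=> i j.
apply: (smoothK_eq Uo Uc _ (smoothK_alg Uo Uc (smooth_christoffel i a j))) => q _.
by rewrite mxE.
Qed.

Lemma smooth_invmetricK : smoothM c U (fun q => invmx (metricK q)).
Proof.
move=> i j; apply: (smoothK_eq Uo Uc _ (smoothK_alg Uo Uc (smooth_gup i j))) => q _.
by rewrite -map_invmx mxE.
Qed.

Lemma metricK_tr q : U q -> (metricK q)^T = metricK q.
Proof. by move=> hq; apply/matrixP => i j; rewrite !mxE (metric_symE i j hq). Qed.

Lemma metricK_unit q : U q -> metricK q \in unitmx.
Proof. by move=> hq; rewrite map_unitmx gU. Qed.

Lemma invmetricK_tr q : U q -> (invmx (metricK q))^T = invmx (metricK q).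
Proof. by move=> hq; rewrite trmx_inv metricK_tr. Qed.

(** Metric compatibility of the Levi-Civita connection. *)
Lemma pdM_metricK a p : U p ->
  pdM c a metricK p = metricK p *m gammaK a p + (metricK p *m gammaK a p)^T.
Proof.
move=> hp.
have L f b : (metricK p *m gammaK a p) f b = (2^-1 * (pd c a (fun q => g q f b) p
    + pd c b (fun q => g q f a) p - pd c f (fun q => g q a b) p))%:A.
  rewrite -christoffel_lower // scaler_suml mxE; apply: eq_bigr => e _.
  by rewrite !mxE /= -scalerAl mul1r scalerA.
apply/matrixP => f b; rewrite [RHS]mxE [X in _ + X]mxE !L -scalerDl.
rewrite pdME.
rewrite (pdK_eq Uo Uc (g := fun q => (g q f b)%:A) a hp) => [|q _]; last by rewrite mxE.
rewrite (pdK_alg K Uo Uc) //; congr (_ *: _).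
have E x y z : pd c x (fun q => g q y z) p = pd c x (fun q => g q z y) p.
  by apply: (pd_eq Uo Uc x hp) => q; exact: metric_symE.
by rewrite (E b f a) (E f b a) (E a b f); field.
Qed.

(** Metric compatibility for the inverse metric, from differentiating
    [g g^-1 = 1]. *)
Lemma pdM_invmetricK a p : U p -> pdM c a (fun q => invmx (metricK q)) p =
  - (gammaK a p *m invmx (metricK p)) - (gammaK a p *m invmx (metricK p))^T.
Proof.
move=> hp; set V := invmx (metricK p).
have VG : V *m metricK p = 1%:M by rewrite mulVmx // metricK_unit.
have GV : metricK p *m V = 1%:M by rewrite mulmxV // metricK_unit.
have : pdM c a (fun q => metricK q *m invmx (metricK q)) p = 0.
  rewrite (pdM_eq Uo Uc (Z := fun=> 1%:M) a hp); first exact: (pdM_cst Uc).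
  by move=> q hq; rewrite mulmxV // metricK_unit.
rewrite (pdM_mul Uo Uc a smooth_metricK smooth_invmetricK hp) -/V.
move/(congr1 (mulmx V)); rewrite mulmxDr mulmx0 !mulmxA VG mul1mx => /eqP.
rewrite addrC addr_eq0 => /eqP ->; rewrite pdM_metricK // !trmx_mul metricK_tr //.
rewrite invmetricK_tr // -/V mulmxDr mulmxDl !mulmxA VG mul1mx -!mulmxA GV mulmx1.
by rewrite opprD.
Qed.

Definition riemK a b p : 'M[K]_6 := pdM c a (gammaK b) p - pdM c b (gammaK a) p
  + (gammaK a p *m gammaK b p - gammaK b p *m gammaK a p).

Lemma riemE a b e f p : U p -> (riem c g a b e f p)%:A = riemK a b p e f.
Proof.
move=> hp.
have NE x h q : U q -> nabla_vec c g (fun e' _ => (e' == f)%:R) x h q =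
    christoffel c g h x f q.
  move=> hq; rewrite /nabla_vec (pd_cst Uc) // add0r (bigD1 f) //=.
  by rewrite eqxx mulr1 big1 ?addr0 // => i /negPf ->; rewrite mulr0.
have M x y : nabla_mix c g (nabla_vec c g (fun e' _ => (e' == f)%:R)) x y e p =
   pd c x (christoffel c g e y f) p
    + \sum_h christoffel c g e x h p * christoffel c g h y f p
    - \sum_h christoffel c g h x y p * christoffel c g e h f p.
  rewrite /nabla_mix; congr (_ + _ - _).
  - by apply: (pd_eq Uo Uc x hp) => q; exact: NE.
  - by apply: eq_bigr => h _; rewrite NE.
  - by apply: eq_bigr => h _; rewrite NE.
have PE x y : pdM c x (gammaK y) p e f = (pd c x (christoffel c g e y f) p)%:A.
  rewrite pdME.
  rewrite -(pdK_alg K Uo Uc) //; last exact: smooth_christoffel.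
  by apply: (pdK_eq Uo Uc x hp) => q _; rewrite mxE.
have GG x y : (gammaK x p *m gammaK y p) e f =
    (\sum_h christoffel c g e x h p * christoffel c g h y f p)%:A.
  rewrite mxE scaler_suml; apply: eq_bigr => h _.
  by rewrite !mxE -scalerAl mul1r scalerA.
have TT : \sum_h christoffel c g h b a p * christoffel c g e h f p =
    \sum_h christoffel c g h a b p * christoffel c g e h f p.
  by apply: eq_bigr => h _; rewrite christoffelC.
exact: (riem_identity (M a b) (M b a) TT (PE a b) (PE b a) (GG a b) (GG b a)).
Qed.

Lemma smooth_metric_gamma a : smoothM c U (fun q => metricK q *m gammaK a q).
Proof. exact: (smoothM_mul Uo Uc smooth_metricK (smooth_gammaK a)). Qed.

(** The Riemann tensor is skew in its last two indices: this is the symmetry of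
    the second derivatives of the metric. *)
Lemma riemK_skew a b p : U p ->
  (metricK p *m riemK a b p)^T = - (metricK p *m riemK a b p).
Proof.
move=> hp.
have D x y : pdM c x (pdM c y metricK) p =
    let Y := metricK p *m gammaK x p *m gammaK y p +
      (gammaK x p)^T *m metricK p *m gammaK y p +
      metricK p *m pdM c x (gammaK y) p in Y + Y^T.
  rewrite (pdM_eq Uo Uc (Z := fun q => metricK q *m gammaK y q +
    (metricK q *m gammaK y q)^T) x hp) => [|q hq]; last exact: pdM_metricK.
  have S : smoothM c U (fun q => (metricK q *m gammaK y q)^T).
    by move=> i j; apply: (smoothK_eq Uo Uc _ (smooth_metric_gamma y j i)) => q _;
      rewrite [RHS]mxE.
  rewrite (pdMD Uo Uc x (smooth_metric_gamma y) S hp).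
  rewrite pdM_tr (pdM_mul Uo Uc x smooth_metricK (smooth_gammaK y) hp).
  by rewrite pdM_metricK // trmx_mul metricK_tr // mulmxDl.
exact: (skew_identity (metricK_tr hp) (D a b) (D b a) (pdM_pdMC Uo Uc a b smooth_metricK hp)).
Qed.

End MetricConnection.

(** * Bundle-valued 2-tensors at a point *)

Section TwoTensors.
Context (K : fieldType) (n r : nat).
Implicit Types (M : 'M[K]_n) (s t : 'I_n -> 'I_n -> 'M[K]_r) (a b d e f : 'I_n).

(** A matrix acts on the first index of a 2-tensor by [lmulT] and on the second
    by [rmulT]. The two actions commute, and [M^T] is adjoint to [M] for the
    pairing [contr]; index manipulations become matrix identities in this way. *)
Definition lmulT M t d e : 'M[K]_r := \sum_f M f d *: t f e.
Definition rmulT M t d e : 'M[K]_r := \sum_f M f e *: t d f.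
Definition contr s t : K := \sum_a \sum_b \tr (s a b *m t a b).
(** With [M] the inverse metric, this raises both indices. *)
Definition raise2 M t d e := lmulT M (rmulT M t) d e.

Lemma lmulT_eq M s t d e : (forall d e, s d e = t d e) -> lmulT M s d e = lmulT M t d e.
Proof. by move=> E; apply: eq_bigr => f _; rewrite E. Qed.

Lemma rmulT_eq M s t d e : (forall d e, s d e = t d e) -> rmulT M s d e = rmulT M t d e.
Proof. by move=> E; apply: eq_bigr => f _; rewrite E. Qed.

Lemma lmulT_comp M1 M2 t d e : lmulT M1 (lmulT M2 t) d e = lmulT (M2 *m M1) t d e.
Proof.
rewrite /lmulT; under eq_bigr => f _ do rewrite scaler_sumr.
rewrite exchange_big; apply: eq_bigr => h _; rewrite mxE scaler_suml.
by apply: eq_bigr => f _; rewrite scalerA mulrC.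
Qed.

Lemma rmulT_comp M1 M2 t d e : rmulT M1 (rmulT M2 t) d e = rmulT (M2 *m M1) t d e.
Proof.
rewrite /rmulT; under eq_bigr => f _ do rewrite scaler_sumr.
rewrite exchange_big; apply: eq_bigr => h _; rewrite mxE scaler_suml.
by apply: eq_bigr => f _; rewrite scalerA mulrC.
Qed.

Lemma lmulT_rmulT M1 M2 t d e : lmulT M1 (rmulT M2 t) d e = rmulT M2 (lmulT M1 t) d e.
Proof.
rewrite /lmulT /rmulT; under eq_bigr => f _ do rewrite scaler_sumr.
rewrite exchange_big; apply: eq_bigr => h _; rewrite scaler_sumr.
by apply: eq_bigr => f _; rewrite !scalerA mulrC.
Qed.

Lemma lmulTDl M1 M2 t d e : lmulT (M1 + M2) t d e = lmulT M1 t d e + lmulT M2 t d e.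
Proof. by rewrite -big_split; apply: eq_bigr => f _; rewrite mxE scalerDl. Qed.

Lemma rmulTDl M1 M2 t d e : rmulT (M1 + M2) t d e = rmulT M1 t d e + rmulT M2 t d e.
Proof. by rewrite -big_split; apply: eq_bigr => f _; rewrite mxE scalerDl. Qed.

Lemma lmulTN M t d e : lmulT (- M) t d e = - lmulT M t d e.
Proof. by rewrite -sumrN; apply: eq_bigr => f _; rewrite mxE scaleNr. Qed.

Lemma rmulTN M t d e : rmulT (- M) t d e = - rmulT M t d e.
Proof. by rewrite -sumrN; apply: eq_bigr => f _; rewrite mxE scaleNr. Qed.

Lemma lmulTDr M s t d e : lmulT M (fun d e => s d e + t d e) d e =
  lmulT M s d e + lmulT M t d e.
Proof. by rewrite -big_split; apply: eq_bigr => f _; rewrite scalerDr. Qed.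

Lemma rmulTDr M s t d e : rmulT M (fun d e => s d e + t d e) d e =
  rmulT M s d e + rmulT M t d e.
Proof. by rewrite -big_split; apply: eq_bigr => f _; rewrite scalerDr. Qed.

Lemma lmulTNr M t d e : lmulT M (fun d e => - t d e) d e = - lmulT M t d e.
Proof. by rewrite -sumrN; apply: eq_bigr => f _; rewrite scalerN. Qed.

Lemma rmulTNr M t d e : rmulT M (fun d e => - t d e) d e = - rmulT M t d e.
Proof. by rewrite -sumrN; apply: eq_bigr => f _; rewrite scalerN. Qed.

Lemma contr_eq s s' t t' : (forall a b, s a b = s' a b) -> (forall a b, t a b = t' a b) ->
  contr s t = contr s' t'.
Proof.
by move=> E E'; apply: eq_bigr => a _; apply: eq_bigr => b _; rewrite E E'.
Qed.

Lemma contrC s t : contr s t = contr t s.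
Proof. by do 2![apply: eq_bigr => ? _]; rewrite mxtrace_mulC. Qed.

Lemma contrDr s t t' : contr s (fun a b => t a b + t' a b) = contr s t + contr s t'.
Proof.
rewrite -big_split; apply: eq_bigr => a _; rewrite -big_split; apply: eq_bigr => b _.
by rewrite mulmxDr linearD.
Qed.

Lemma contrNr s t : contr s (fun a b => - t a b) = - contr s t.
Proof.
by rewrite -sumrN; apply: eq_bigr => a _; rewrite -sumrN; apply: eq_bigr => b _;
  rewrite mulmxN linearN.
Qed.

Lemma contrZr s (k : K) t : contr s (fun a b => k *: t a b) = k * contr s t.
Proof.
by rewrite mulr_sumr; apply: eq_bigr => a _; rewrite mulr_sumr; apply: eq_bigr => b _;
  rewrite -scalemxAr linearZ.
Qed.

Lemma contrDl s t t' : contr (fun a b => t a b + t' a b) s = contr t s + contr t' s.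
Proof. by rewrite ![contr _ s]contrC contrDr. Qed.

Lemma contrNl s t : contr (fun a b => - t a b) s = - contr t s.
Proof. by rewrite ![contr _ s]contrC contrNr. Qed.

Lemma contr_lmulT M s t : contr (lmulT M^T s) t = contr s (lmulT M t).
Proof.
transitivity (\sum_b \sum_a \sum_f M a f * \tr (s f b *m t a b)).
  rewrite exchange_big; do 2![apply: eq_bigr => ? _].
  rewrite mulmx_suml linear_sum; apply: eq_bigr => f _.
  by rewrite mxE -scalemxAl linearZ.
rewrite [RHS]exchange_big; apply: eq_bigr => b _; rewrite exchange_big /=.
apply: eq_bigr => a _; rewrite mulmx_sumr linear_sum; apply: eq_bigr => f _.
by rewrite -scalemxAr linearZ.
Qed.

Lemma contr_rmulT M s t : contr (rmulT M^T s) t = contr s (rmulT M t).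
Proof.
apply: eq_bigr => a _.
transitivity (\sum_b \sum_f M b f * \tr (s a f *m t a b)).
  apply: eq_bigr => b _; rewrite mulmx_suml linear_sum; apply: eq_bigr => f _.
  by rewrite mxE -scalemxAl linearZ.
rewrite exchange_big; apply: eq_bigr => b _ /=.
by rewrite mulmx_sumr linear_sum; apply: eq_bigr => f _; rewrite -scalemxAr linearZ.
Qed.

(** The pairing of 2-tensors defined by the metric is symmetric: a consequence of
    adjointness and of the cyclicity of the trace. *)
Lemma contr_raise2 M s t : M^T = M -> contr (raise2 M s) t = contr (raise2 M t) s.
Proof.
move=> MT; have -> : contr (raise2 M s) t = contr (lmulT M^T (rmulT M^T s)) t by rewrite MT.
rewrite contr_lmulT contr_rmulT contrC; apply: contr_eq => // a b.
by rewrite -lmulT_rmulT.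
Qed.

Definition contrS M t : 'M[K]_r := \sum_a \sum_b M a b *: t a b.

Lemma contrS_mull M V t : contrS (M *m V) t = contrS V (lmulT M t).
Proof.
transitivity (\sum_b \sum_a \sum_f (M a f * V f b) *: t a b).
  rewrite exchange_big; do 2![apply: eq_bigr => ? _].
  by rewrite mxE scaler_suml.
rewrite [RHS]exchange_big; apply: eq_bigr => b _; rewrite exchange_big /=.
apply: eq_bigr => a _; rewrite scaler_sumr; apply: eq_bigr => f _.
by rewrite scalerA mulrC.
Qed.

Lemma contrS_mulr M V t : contrS (V *m M^T) t = contrS V (rmulT M t).
Proof.
apply: eq_bigr => a _.
transitivity (\sum_b \sum_f (V a f * M b f) *: t a b).
  apply: eq_bigr => b _; rewrite mxE scaler_suml; apply: eq_bigr => f _; by rewrite mxE.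
rewrite exchange_big; apply: eq_bigr => b _ /=.
by rewrite scaler_sumr; apply: eq_bigr => f _; rewrite scalerA.
Qed.

Lemma contrSDl M V t : contrS (M + V) t = contrS M t + contrS V t.
Proof.
rewrite -big_split; apply: eq_bigr => a _; rewrite -big_split; apply: eq_bigr => b _.
by rewrite mxE scalerDl.
Qed.

Lemma contrSNl M t : contrS (- M) t = - contrS M t.
Proof.
by rewrite -sumrN; apply: eq_bigr => a _; rewrite -sumrN; apply: eq_bigr => b _;
  rewrite mxE scaleNr.
Qed.

Lemma contrSDr M s t : contrS M (fun a b => s a b + t a b) = contrS M s + contrS M t.
Proof.
rewrite -big_split; apply: eq_bigr => a _; rewrite -big_split; apply: eq_bigr => b _.
by rewrite scalerDr.
Qed.

Lemma contrSNr M t : contrS M (fun a b => - t a b) = - contrS M t.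
Proof.
by rewrite -sumrN; apply: eq_bigr => a _; rewrite -sumrN; apply: eq_bigr => b _;
  rewrite scalerN.
Qed.

Lemma contrS_eq M s t : (forall a b, s a b = t a b) -> contrS M s = contrS M t.
Proof. by move=> E; do 2![apply: eq_bigr => ? _]; rewrite E. Qed.

Lemma contr_sumZr s (k : 'I_n -> K) (t : 'I_n -> 'I_n -> 'I_n -> 'M[K]_r) :
  contr s (fun a b => \sum_f k f *: t f a b) = \sum_f k f * contr s (t f).
Proof.
transitivity (\sum_a \sum_f \sum_b k f * \tr (s a b *m t f a b)).
  apply: eq_bigr => a _; rewrite [RHS]exchange_big; apply: eq_bigr => b _ /=.
  rewrite mulmx_sumr linear_sum; apply: eq_bigr => f _ /=.
  by rewrite -scalemxAr linearZ.
rewrite exchange_big; apply: eq_bigr => f _ /=.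
by rewrite mulr_sumr; apply: eq_bigr => a _; rewrite mulr_sumr.
Qed.

(** The Christoffel corrections of the covariant derivative of a 3-tensor [t] are
    again a sum of tensors of cyclic type, so they vanish when the cyclic sum of
    [t] does. *)
Lemma cyclic_identity (G : 'M[K]_n) (t : 'I_n -> 'I_n -> 'I_n -> 'M[K]_r) d a b :
  (forall d a b, t d a b + t a b d + t b d a = 0) ->
  let L d a b := lmulT G (t d) a b + rmulT G (t d) a b + \sum_f G f d *: t f a b in
  L d a b + L a b d + L b d a = 0.
Proof.
move=> B; rewrite /= -!big_split /= big1 // => f _.
(* the nine terms, grouped by the index on which the correction acts *)
transitivity (G f a *: (t d f b + t f b d + t b d f) + G f b *: (t d a f + t a f d + t f d a)
  + G f d *: (t f a b + t a b f + t b f a)); last by rewrite !B !scaler0 !addr0.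
by rewrite !scalerDr; apply/matrixP => i j; rewrite !addmxE; ring.
Qed.

Lemma contrS_sum M (k : 'I_n -> K) (t : 'I_n -> 'I_n -> 'I_n -> 'M[K]_r) :
  \sum_f k f *: contrS M (t f) = contrS M (fun a b => \sum_f k f *: t f a b).
Proof.
under eq_bigr => f _ do rewrite scaler_sumr.
rewrite exchange_big; apply: eq_bigr => a _ /=.
under eq_bigr => f _ do rewrite scaler_sumr.
rewrite exchange_big; apply: eq_bigr => b _ /=.
by rewrite scaler_sumr; apply: eq_bigr => f _; rewrite !scalerA mulrC.
Qed.

Lemma raise2_eq M s t d e : (forall d e, s d e = t d e) -> raise2 M s d e = raise2 M t d e.
Proof. by move=> E; apply: lmulT_eq => *; exact: rmulT_eq. Qed.

Lemma contrS_combine M (s1 s2 s3 s4 : 'I_n -> 'I_n -> 'M[K]_r) :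
  - contrS M s1 - contrS M s2 + contrS M s3 - contrS M s4 =
  contrS M (fun a b => - s1 a b - s2 a b + s3 a b - s4 a b).
Proof. by rewrite !(contrSDr, contrSNr). Qed.

(** [NN X dG G1 G2 t1 t2] is a second covariant derivative of [t]: [X] is its
    derivative by the bundle connection alone, [t1] and [t2] are the first such
    derivatives. All terms but the curvatures are symmetric in the two
    directions. *)
Lemma commutator_identity (Xab Xba : 'M[K]_r) (Ga Gb dab dba : 'M[K]_n) t ta tb d e :
  let NN X dG G1 G2 t1 t2 :=
    let Nt d e := t2 d e - lmulT G2 t d e - rmulT G2 t d e in
    X - (lmulT dG t d e + lmulT G2 t1 d e) - (rmulT dG t d e + rmulT G2 t1 d e)
      - lmulT G1 Nt d e - rmulT G1 Nt d e in
  NN Xab dab Ga Gb ta tb - NN Xba dba Gb Ga tb ta =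
  Xab - Xba - lmulT (dab - dba + (Ga *m Gb - Gb *m Ga)) t d e
    - rmulT (dab - dba + (Ga *m Gb - Gb *m Ga)) t d e.
Proof.
rewrite /= !(lmulTDr, rmulTDr, lmulTNr, rmulTNr, lmulTDl, rmulTDl, lmulTN, rmulTN).
rewrite !(lmulT_comp, rmulT_comp, lmulT_rmulT).
by apply/matrixP => i j; rewrite !(addmxE, oppmxE); ring.
Qed.

(** Raising indices commutes with covariant differentiation. [s'] stands for the
    derivative of [s] without Christoffel corrections; the corrections of the
    raised tensor are transposed with the opposite sign. *)
Lemma raise2_identity (V dV G : 'M[K]_n) s s' d e : V^T = V -> dV = - (G *m V) - (G *m V)^T ->
  lmulT dV (rmulT V s) d e + lmulT V (fun d e => rmulT dV s d e + rmulT V s' d e) d e =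
  raise2 V (fun d e => s' d e - lmulT G s d e - rmulT G s d e) d e
    - lmulT G^T (raise2 V s) d e - rmulT G^T (raise2 V s) d e.
Proof.
move=> VT ->; rewrite trmx_mul VT /raise2.
have E1 : rmulT G^T (fun d e => lmulT V (rmulT V s) d e) d e =
    lmulT V (rmulT (V *m G^T) s) d e.
  by rewrite -lmulT_rmulT; apply: lmulT_eq => *; exact: rmulT_comp.
have E2 t : lmulT V (rmulT V (lmulT G t)) d e = lmulT (G *m V) (rmulT V t) d e.
  by rewrite -lmulT_comp; apply: lmulT_eq => *; rewrite lmulT_rmulT.
have E3 : lmulT V (rmulT V (rmulT G s)) d e = lmulT V (rmulT (G *m V) s) d e.
  by apply: lmulT_eq => *; exact: rmulT_comp.
have E4 : lmulT V (fun d e => rmulT (- (G *m V) - V *m G^T) s d e + rmulT V s' d e) d e =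
    - lmulT V (rmulT (G *m V) s) d e - lmulT V (rmulT (V *m G^T) s) d e
    + lmulT V (rmulT V s') d e.
  rewrite -!lmulTNr -!lmulTDr; apply: lmulT_eq => *.
  by rewrite rmulTDl !rmulTN.
have E5 : lmulT V (rmulT V (fun d e => s' d e - lmulT G s d e - rmulT G s d e)) d e =
    lmulT V (rmulT V s') d e - lmulT (G *m V) (rmulT V s) d e
    - lmulT V (rmulT (G *m V) s) d e.
  rewrite -E2 -[in RHS]E3 -!lmulTNr -!lmulTDr; apply: lmulT_eq => *.
  by rewrite !rmulTDr !rmulTNr.
rewrite E1 E4 E5 lmulT_comp !lmulTDl !lmulTN.
by apply/matrixP => i j; rewrite !(addmxE, oppmxE); ring.
Qed.

Lemma contr_leibniz_identity (G : 'M[K]_n) s' s t' t :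
  contr (fun d e => s' d e - lmulT G^T s d e - rmulT G^T s d e) t + contr s t' =
  contr s' t + contr s (fun d e => t' d e - lmulT G t d e - rmulT G t d e).
Proof.
rewrite !(contrDl, contrNl, contrDr, contrNr) contr_lmulT contr_rmulT; ring.
Qed.

End TwoTensors.

(** * The curvature terms of the Bochner formula *)

Lemma sum_exchange4 (S : nmodType) n (T : 'I_n -> 'I_n -> 'I_n -> 'I_n -> S) :
  \sum_a \sum_b \sum_c \sum_d T a b c d = \sum_c \sum_d \sum_a \sum_b T a b c d.
Proof.
transitivity (\sum_a \sum_c \sum_d \sum_b T a b c d).
  apply: eq_bigr => a _; rewrite exchange_big; apply: eq_bigr => c _ /=.
  by rewrite exchange_big.
by rewrite exchange_big; apply: eq_bigr => c _ /=; rewrite exchange_big.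
Qed.

(** Pointwise data: inverse metric [V], metric [G], Schouten tensor [P] with trace
    [J], bundle curvature [F], Riemann curvature [(Rm a b)_ef = R_ab^e_f] and Weyl
    tensor [W]. *)
Section CurvatureAlgebra.
Context (K : fieldType) (n r : nat).
Context (V G P : 'M[K]_n) (J : K) (F : 'I_n -> 'I_n -> 'M[K]_r).
Context (Rm : 'I_n -> 'I_n -> 'M[K]_n) (W : 'I_n -> 'I_n -> 'I_n -> 'I_n -> K).
Hypothesis char_neq2 : (2 : K) != 0.
Hypothesis VT : V^T = V.
Hypothesis GT : G^T = G.
Hypothesis VG : V *m G = 1%:M.
Hypothesis FC : forall a b, F a b = - F b a.
Hypothesis RmC : forall a b, Rm a b = - Rm b a.
Hypothesis Rm_skew : forall a b, (G *m Rm a b)^T = - (G *m Rm a b).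
Hypothesis Rm_ricci : forall a k, \sum_c Rm a c c k = - (4 * P a k + J * G a k).
Hypothesis Rm_weyl : forall c a b k, (G *m Rm c a) b k =
  W c a b k + (G c b * P a k - G a b * P c k + G a k * P c b - G c k * P a b).
Implicit Types (s t : 'I_n -> 'I_n -> 'M[K]_r) (a b d e f k : 'I_n).

Local Notation Fu := (raise2 V F).

Lemma raise2C a b : Fu a b = - Fu b a.
Proof.
rewrite /raise2 lmulT_rmulT -lmulTNr.
rewrite /rmulT /lmulT; apply: eq_bigr => f _; congr (_ *: _).
by rewrite -sumrN; apply: eq_bigr => e _; rewrite FC scalerN.
Qed.

Lemma contr_swap t : contr Fu (fun a b => t b a) = - contr Fu t.
Proof.
rewrite /contr exchange_big -sumrN; apply: eq_bigr => a _.
rewrite -sumrN; apply: eq_bigr => b _ /=.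
by rewrite raise2C mulNmx linearN.
Qed.

Lemma contrS_swap t : contrS V (fun a b => t b a) = contrS V t.
Proof.
rewrite /contrS exchange_big; do 2![apply: eq_bigr => ? _].
by rewrite -[in LHS]VT mxE.
Qed.

Lemma rmulT_antisym M a b : rmulT M F a b = - lmulT M F b a.
Proof. by rewrite -sumrN; apply: eq_bigr => f _; rewrite FC scalerN. Qed.

Lemma contr_rmulT_antisym M : contr Fu (rmulT M F) = contr Fu (lmulT M F).
Proof.
rewrite (@contr_eq _ _ _ Fu Fu _ (fun a b => - lmulT M F b a)) //; last exact: rmulT_antisym.
by rewrite contrNr (contr_swap (lmulT M F)) opprK.
Qed.

(** The trace of [F_ae V^ef F_bf] is symmetric in [a] and [b], so only the
    symmetric part of [M] contributes. *)
Lemma contr_transpose M : contr (rmulT V F) (lmulT M F) = contr (rmulT V F) (lmulT M^T F).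
Proof.
rewrite -[LHS]contr_lmulT.
transitivity (contr (rmulT V^T (lmulT M^T F)) F).
  by apply: contr_eq => // a b; rewrite VT lmulT_rmulT.
by rewrite contr_rmulT contrC.
Qed.

Lemma contr_raise2_lmulT M : contr Fu (lmulT M F) = contr (rmulT V F) (lmulT (M *m V) F).
Proof.
transitivity (contr (lmulT V^T (rmulT V F)) (lmulT M F)); first by rewrite VT.
by rewrite contr_lmulT; apply: contr_eq => // a b; exact: lmulT_comp.
Qed.

Lemma contr_schouten_transpose : contr Fu (lmulT (V *m P) F) = contr Fu (lmulT (V *m P^T) F).
Proof.
rewrite !contr_raise2_lmulT contr_transpose.
by rewrite !trmx_mul VT mulmxA.
Qed.

(** The skewness of the lowered curvature, for the curvature with its third index
    up. *)
Lemma Rm_transpose c a : Rm c a *m V = - (V *m (Rm c a)^T).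
Proof.
have := congr1 (fun M => V *m M *m V) (Rm_skew c a).
rewrite trmx_mul GT mulmxN mulNmx !mulmxA VG mul1mx -mulmxA.
have -> : G *m V = 1%:M by apply: mulmx1C.
by rewrite mulmx1 => ->; rewrite opprK.
Qed.

(** The trace of the Riemann tensor produced by contracting the commutator is the
    Ricci tensor, here written by the Schouten tensor and its trace. *)
Lemma ricci_term a b : contrS V (fun c d => rmulT (Rm c a) F b d) =
  4 *: lmulT (V *m P^T) F a b + J *: F a b.
Proof.
have E h : \sum_c \sum_d V c d * Rm c a h d = - (4 * (V *m P^T) h a + J * (h == a)%:R).
  transitivity (\sum_c (Rm c a *m V) h c).
    apply: eq_bigr => c _; rewrite mxE; apply: eq_bigr => d _.
    by rewrite -[in LHS]VT mxE mulrC.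
  transitivity (\sum_c \sum_k V h k * Rm a c c k).
    apply: eq_bigr => c _; rewrite Rm_transpose oppmxE mxE -sumrN.
    by apply: eq_bigr => k _; rewrite mxE [in LHS]RmC oppmxE mulrN opprK.
  rewrite exchange_big /=.
  transitivity (- (4 * (V *m P^T) h a + J * (V *m G) h a)); last first.
    have -> : (V *m G) h a = (h == a)%:R by rewrite VG mxE.
    by [].
  rewrite !mxE !mulr_sumr -big_split -sumrN /=; apply: eq_bigr => k _.
  have GE : G k a = G a k by rewrite -[in LHS]GT mxE.
  by rewrite -mulr_sumr Rm_ricci mxE GE; ring.
transitivity (\sum_h (\sum_c \sum_d V c d * Rm c a h d) *: F b h).
  transitivity (\sum_c \sum_h \sum_d (V c d * Rm c a h d) *: F b h).
    apply: eq_bigr => c _; rewrite exchange_big; apply: eq_bigr => d _ /=.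
    by rewrite scaler_sumr; apply: eq_bigr => h _; rewrite scalerA.
  rewrite exchange_big; apply: eq_bigr => h _ /=; rewrite scaler_suml.
  by apply: eq_bigr => c _; rewrite scaler_suml.
transitivity (\sum_h (4 * (V *m P^T) h a + J * (h == a)%:R) *: F h b).
  by apply: eq_bigr => h _; rewrite E FC scalerN scaleNr opprK.
under eq_bigr => h _ do rewrite scalerDl; rewrite big_split /=; congr (_ + _).
  by rewrite scaler_sumr; apply: eq_bigr => h _; rewrite scalerA.
rewrite (bigD1 a) //= eqxx mulr1 big1 ?addr0 // => h /negPf ->.
by rewrite mulr0 scale0r.
Qed.


(** Lowering an index of the curvature raises both indices of [F], which gives the
    form to which the decomposition into Weyl and Schouten tensors applies. *)
Lemma riem_term a b : contrS V (fun c d => lmulT (Rm c a) F b d) =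
  - (\sum_c \sum_k (G *m Rm c a) b k *: Fu k c) :> 'M[K]_r.
Proof.
have E c h : Rm c a h b = - \sum_k V h k * (G *m Rm c a) b k.
  transitivity ((V *m (G *m Rm c a)) h b); first by rewrite mulmxA VG mul1mx.
  rewrite mxE -sumrN; apply: eq_bigr => k _; rewrite -mulrN; congr (_ * _).
  by rewrite -oppmxE -Rm_skew [RHS]mxE.
rewrite -sumrN; apply: eq_bigr => c _.
transitivity (- \sum_d \sum_h \sum_k (V c d * V h k * (G *m Rm c a) b k) *: F h d).
  rewrite -sumrN; apply: eq_bigr => d _; rewrite scaler_sumr -sumrN.
  apply: eq_bigr => h _; rewrite E scaleNr scalerN scaler_suml scaler_sumr.
  by congr (- _); apply: eq_bigr => k _; rewrite scalerA mulrA.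
congr (- _).
transitivity (\sum_k \sum_h \sum_d (V c d * V h k * (G *m Rm c a) b k) *: F h d).
  rewrite exchange_big [RHS]exchange_big; apply: eq_bigr => h _ /=.
  by rewrite exchange_big.
apply: eq_bigr => k _; rewrite scaler_sumr; apply: eq_bigr => h _.
rewrite !scaler_sumr; apply: eq_bigr => d _; rewrite !scalerA; congr (_ *: _).
have -> : V d c = V c d by rewrite -[in LHS]VT mxE.
by ring.
Qed.

Lemma opp_eq0 m (Z : 'M[K]_m) : Z = - Z -> Z = 0.
Proof.
move=> E; have : 2 *: Z = 0 by rewrite scaler_nat mulr2n {2}E subrr.
by move/eqP; rewrite scaler_eq0 (negPf char_neq2) /= => /eqP.
Qed.

(** A symmetric tensor contracted with a skew one. *)
Lemma contr_sym0 (k : K) (Z : 'M[K]_r) : contr Fu (fun a b => (k * G a b) *: Z) = 0.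
Proof.
have E : contr Fu (fun a b => (k * G a b) *: Z) = - contr Fu (fun a b => (k * G a b) *: Z).
  rewrite -(contr_swap (fun a b => (k * G a b) *: Z)); apply: contr_eq => // a b.
  by rewrite -[in LHS]GT mxE.
have : 2 * contr Fu (fun a b => (k * G a b) *: Z) = 0.
  by rewrite mulr_natl mulr2n {2}E subrr.
by move/eqP; rewrite mulf_eq0 (negPf char_neq2) /= => /eqP.
Qed.

Lemma contrG0 : \sum_c \sum_k G c k *: Fu k c = 0 :> 'M[K]_r.
Proof.
apply: opp_eq0; rewrite [LHS]exchange_big -sumrN; apply: eq_bigr => c _ /=.
rewrite -sumrN; apply: eq_bigr => k _; rewrite raise2C scalerN.
by rewrite -[in LHS]GT mxE.
Qed.

Lemma lower_right d e : rmulT G Fu d e = lmulT V F d e.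
Proof.
rewrite /raise2 -lmulT_rmulT; apply: lmulT_eq => d' e'; rewrite rmulT_comp VG.
rewrite /rmulT (bigD1 e') //= mxE eqxx scale1r big1 ?addr0 // => f /negPf fe.
by rewrite mxE fe scale0r.
Qed.

Lemma lower_left d e : lmulT G Fu d e = rmulT V F d e.
Proof.
rewrite /raise2 lmulT_comp VG.
rewrite /lmulT (bigD1 d) //= mxE eqxx scale1r big1 ?addr0 // => f /negPf fe.
by rewrite mxE fe scale0r.
Qed.

Lemma schouten_term1 a b : \sum_c \sum_k (G c b * P a k) *: Fu k c = lmulT (V *m P^T) F a b.
Proof.
rewrite -lmulT_comp exchange_big; apply: eq_bigr => k _ /=.
rewrite mxE -lower_right scaler_sumr; apply: eq_bigr => c _.
by rewrite scalerA mulrC.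
Qed.

Lemma schouten_term3 a b : \sum_c \sum_k (G a k * P c b) *: Fu k c = rmulT (V *m P) F a b.
Proof.
rewrite -rmulT_comp; apply: eq_bigr => c _ /=.
rewrite -lower_left scaler_sumr; apply: eq_bigr => k _.
by rewrite scalerA mulrC -[in LHS]GT mxE.
Qed.

(** Of the four products of [G] and [P], the one with [G_ab] dies later against
    the skew tensor [Fu], the one with [G_ck] vanishes at once, and the other two
    are the two ways of contracting [P] with [F]. *)
Lemma riem_sum a b : \sum_c \sum_k (G *m Rm c a) b k *: Fu k c =
  \sum_c \sum_k W c a b k *: Fu k c + lmulT (V *m P^T) F a b + rmulT (V *m P) F a b
  - (1 * G a b) *: (\sum_c \sum_k P c k *: Fu k c).
Proof.
rewrite -schouten_term1 -schouten_term3 mul1r.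
transitivity (\sum_c \sum_k W c a b k *: Fu k c + \sum_c \sum_k (G c b * P a k) *: Fu k c
  + \sum_c \sum_k (G a k * P c b) *: Fu k c - G a b *: (\sum_c \sum_k P c k *: Fu k c)
  - P a b *: (\sum_c \sum_k G c k *: Fu k c)); last by rewrite contrG0 scaler0 subr0.
rewrite !scaler_sumr -!sumrN -!big_split /=; apply: eq_bigr => c _.
rewrite !scaler_sumr -!sumrN -!big_split /=; apply: eq_bigr => k _.
rewrite Rm_weyl !scalerA -!scaleNr -!scalerDl; congr (_ *: _); ring.
Qed.

(** Reversing the order of a product of three curvatures changes its sign, because
    each factor is skew; so the commutator doubles the cubic term. *)
Lemma contr_commutator : contr Fu (fun a b => contrS V (fun c d => F b d *m F c a)) =
  - contr Fu (fun a b => contrS V (fun c d => F c a *m F b d)).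
Proof.
rewrite -contr_swap; apply: contr_eq => // a b; rewrite -contrS_swap.
by apply: contrS_eq => c d; rewrite [in LHS]FC [F d a]FC mulNmx mulmxN opprK.
Qed.

(** The curvature acting on [F] in the commutator of two derivatives, contracted
    with [F]: [4 P + g J] from the Ricci tensor, twice [-P] and [W] from the rest of
    the Riemann tensor, and twice the cubic term. *)
Lemma curvature_contraction :
  contr Fu (fun a b => contrS V (fun c d => F c a *m F b d - F b d *m F c a
    - lmulT (Rm c a) F b d - rmulT (Rm c a) F b d)) =
  2 * contr Fu (fun a b => contrS V (fun c d => F c a *m F b d))
  - 2 * contr Fu (lmulT (V *m P^T) F) - J * contr Fu F
  + contr Fu (fun a b => \sum_c \sum_k W c a b k *: Fu k c).
Proof.
transitivity (contr Fu (fun a b => contrS V (fun c d => F c a *m F b d)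
    - contrS V (fun c d => F b d *m F c a)
    + (\sum_c \sum_k W c a b k *: Fu k c + lmulT (V *m P^T) F a b + rmulT (V *m P) F a b
      - (1 * G a b) *: (\sum_c \sum_k P c k *: Fu k c))
    - (4 *: lmulT (V *m P^T) F a b + J *: F a b))).
  apply: contr_eq => // a b; rewrite -riem_sum -ricci_term.
  by rewrite !(contrSDr, contrSNr) riem_term opprK.
rewrite !(contrDr, contrNr, contrZr) contr_commutator contr_sym0.
rewrite contr_rmulT_antisym contr_schouten_transpose; ring.
Qed.

Context (H : 'I_n -> 'I_n -> 'I_n -> 'I_n -> 'M[K]_r).
Hypothesis HC : forall c d a b, H c d a b = - H c d b a.
Hypothesis H_bianchi : forall c d a b, H c d a b + H c a b d + H c b d a = 0.
Hypothesis H_ricci : forall c a b d, H c a b d - H a c b d =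
  F c a *m F b d - F b d *m F c a - lmulT (Rm c a) F b d - rmulT (Rm c a) F b d.

Lemma contr_contrS s (t : 'I_n -> 'I_n -> 'I_n -> 'I_n -> 'M[K]_r) :
  contr s (fun a b => contrS V (fun c d => t c d a b)) =
  \sum_c \sum_d V c d * contr s (t c d).
Proof.
transitivity (\sum_a \sum_b \sum_c \sum_d V c d * \tr (s a b *m t c d a b)).
  do 2![apply: eq_bigr => ? _]; rewrite mulmx_sumr linear_sum; apply: eq_bigr => c _.
  rewrite mulmx_sumr linear_sum; apply: eq_bigr => d _ /=.
  by rewrite -scalemxAr linearZ.
rewrite sum_exchange4; do 2![apply: eq_bigr => ? _].
by rewrite mulr_sumr; apply: eq_bigr => a _; rewrite mulr_sumr.
Qed.

(** With [H c d a b] the second derivative [nabla_c nabla_d F_ab], the Bianchi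
    identity turns [F^ab H^c_cab] into [-2 F^ab H^c_abc]; exchanging the first two
    derivatives leaves the divergence [H_a^c_cb] and a commutator. *)
Lemma bochner :
  \sum_c \sum_d V c d * contr Fu (H c d) =
  2 * contr Fu (fun a b => contrS V (fun c e => H a c e b))
  - 2 * contr Fu (fun a b => contrS V (fun c d => F c a *m F b d - F b d *m F c a
    - lmulT (Rm c a) F b d - rmulT (Rm c a) F b d)).
Proof.
rewrite -contr_contrS.
have E1 : contr Fu (fun a b => contrS V (fun c d => H c d a b)) =
    - 2 * contr Fu (fun a b => contrS V (fun c d => H c a b d)).
  transitivity (contr Fu (fun a b => - contrS V (fun c d => H c a b d)
    + contrS V (fun c d => H c b a d))).
    apply: contr_eq => // a b; rewrite -contrSNr -contrSDr; apply: contrS_eq => c d.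
    have /eqP := H_bianchi c d a b; rewrite -addrA addr_eq0 => /eqP ->.
    by rewrite opprD [H c b d a]HC opprK.
  rewrite contrDr contrNr (contr_swap (fun a b => contrS V (fun c d => H c a b d))); ring.
have E2 : contr Fu (fun a b => contrS V (fun c d => H c a b d)) =
    - contr Fu (fun a b => contrS V (fun c e => H a c e b))
    + contr Fu (fun a b => contrS V (fun c d => F c a *m F b d - F b d *m F c a
    - lmulT (Rm c a) F b d - rmulT (Rm c a) F b d)).
  rewrite -contrNr -contrDr; apply: contr_eq => // a b.
  rewrite -contrSNr -contrSDr; apply: contrS_eq => c d.
  by rewrite -H_ricci [H a c d b]HC opprK addrC subrK.
rewrite E1 E2; ring.
Qed.

End CurvatureAlgebra.

(** * Covariant derivatives of the bundle curvature *)

Lemma antisym_identity (V : zmodType) (x y l1 l2 r1 r2 : V) :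
  x = - y -> l1 = - r2 -> l2 = - r1 -> x - l1 - r1 = - (y - l2 - r2).
Proof. by move=> -> -> ->; rewrite !opprD !opprK addrAC. Qed.

Lemma cyclic3_identity (K : comNzRingType) n (x y z l1 l2 l3 r1 r2 r3 : 'M[K]_n) :
  l1 = - r1 -> l2 = - r2 -> l3 = - r3 ->
  (x - l1 - r3) + (y - l2 - r1) + (z - l3 - r2) = x + y + z.
Proof.
by move=> -> -> ->; apply/matrixP => i j; rewrite !(addmxE, oppmxE); ring.
Qed.

Lemma subr_common (V : zmodType) (x y s1 s2 : V) : s1 = s2 -> (x - s1) - (y - s2) = x - y.
Proof. by move=> ->; rewrite opprB addrA subrK. Qed.

Lemma laplacian_identity (K : comNzRingType) (v x y s : K) :
  v * (2 * (x + y) - 2 * s) = 2 * (v * x) + 2 * (v * (y - s)).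
Proof. by ring. Qed.

Lemma current_identity (K : comNzRingType) n (N D L1 R1 L2 h : 'M[K]_n) :
  N = D - R1 - L2 -> h = N - L1 -> - L1 - R1 + D - L2 = h.
Proof.
by move=> -> ->; apply/matrixP => i j; rewrite !(addmxE, oppmxE); ring.
Qed.

(** Both integrands as linear combinations of the same scalars. [NN] is the square
    of [nabla F] and [X] the contraction of [F] with its Laplacian, which the last
    two equations express by the remaining terms. *)
Lemma anomaly_identity (R : realType) (K : fieldExtType R) n (k : R)
    (lap jj nj P sq nn W F3 : 'M[K]_n) (NN X Y S C Q Wt F : K) : (2 : K) != 0 ->
  \tr lap = 2 * NN + 2 * X -> \tr nn = NN -> \tr nj = Y -> \tr sq = S ->
  \tr P = - Q -> \tr W = Wt -> \tr F3 = F ->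
  X = 2 * Y - 2 * C -> C = 2 * F - 2 * Q - k%:A * S + Wt ->
  \tr (- (4^-1 *: lap) - jj - 2 *: nj + 4 *: P + k *:' sq) =
  \tr (- jj - 2^-1 *: nn + 6 *: P - 3 *: nj + W + 2 *: F3).
Proof.
move=> K2 El En Ej Es EP EW EF EX EC; rewrite /rscale.
rewrite !(linearD, linearN, linearZ) /= El En Ej Es EP EW EF EX EC.
have K4 : (4 : K) != 0 by rewrite (natrM K 2 2) mulf_neq0.
by field; rewrite K2 K4.
Qed.

Lemma sub3_identity (V : zmodType) (h1 h2 h3 x1 x2 x3 y1 y2 y3 : V) :
  h1 = x1 - y1 -> h2 = x2 - y2 -> h3 = x3 - y3 ->
  x1 + x2 + x3 = 0 -> y1 + y2 + y3 = 0 -> h1 + h2 + h3 = 0.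
Proof.
move=> -> -> -> Ex Ey.
by rewrite (addrACA x1) (addrACA (x1 + x2)) Ex -!opprD Ey subr0.
Qed.

Lemma curvature_identity (K : comNzRingType) n (x y Y Ya Yb Yab Yba Aa Ab dab dba F : 'M[K]_n) :
  x = Yab + (dab *m Y + Ab *m Ya) - (Ya *m Ab + Y *m dab)
    + Aa *m (Yb + Ab *m Y - Y *m Ab) - (Yb + Ab *m Y - Y *m Ab) *m Aa ->
  y = Yba + (dba *m Y + Aa *m Yb) - (Yb *m Aa + Y *m dba)
    + Ab *m (Ya + Aa *m Y - Y *m Aa) - (Ya + Aa *m Y - Y *m Aa) *m Ab ->
  Yab = Yba -> F = dab - dba + (Aa *m Ab - Ab *m Aa) ->
  x - y = F *m Y - Y *m F.
Proof.
move=> -> -> -> ->.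
rewrite !(mulmxDl, mulmxDr, mulNmx, mulmxN, mulmxA).
by apply/matrixP => i j; rewrite !(addmxE, oppmxE); ring.
Qed.

(** With [A x] a connection form, [d x y] and [dd x y z] its first and second
    derivatives, [cov x y z] is the covariant derivative of the curvature: this is
    the Bianchi identity. *)
Lemma bianchi_identity (I : Type) (K : comNzRingType) n (dd : I -> I -> I -> 'M[K]_n)
    (d : I -> I -> 'M[K]_n) (A : I -> 'M[K]_n) a b e :
  (forall x y z, dd x y z = dd y x z) ->
  let cov x y z := dd x y z - dd x z y
    + (d x y *m A z + A y *m d x z - (d x z *m A y + A z *m d x y))
    + A x *m (d y z - d z y + (A y *m A z - A z *m A y))
    - (d y z - d z y + (A y *m A z - A z *m A y)) *m A x in
  cov a b e + cov b e a + cov e a b = 0.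
Proof.
move=> C /=; rewrite (C b a e) (C e a b) (C e b a).
rewrite !(mulmxDl, mulmxDr, mulNmx, mulmxN, mulmxA).
by apply/matrixP => i j; rewrite !(addmxE, oppmxE) [RHS]mxE; ring.
Qed.

Section Coupled.
Context (R : realType) (X : topologicalType) (c : chart R X).
Context (K : fieldExtType R) (r : nat).
Context (U : set X) (Uo : open U) (Uc : U `<=` cdom c).
Context (g : X -> 'M[R]_6).
Hypothesis gS : forall a b, smooth c U (fun q => g q a b).
Hypothesis gT : forall q, U q -> (g q)^T = g q.
Hypothesis gU : forall q, U q -> g q \in unitmx.
Context (A : 'I_6 -> X -> 'M[K]_r).
Hypothesis AS : forall a, smoothM c U (A a).
Implicit Types (a b d e f h : 'I_6) (p q : X) (Y Z : X -> 'M[K]_r).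
Implicit Types (s t : 'I_6 -> 'I_6 -> X -> 'M[K]_r).

Local Opaque pd pdK pdM.

Local Notation D := (nabla_end c A).
Local Notation Gm := (gammaK c K g).
Local Notation V := (fun q => invmx (metricK K g q)).
Local Notation F := (curv c g A).
Local Notation N := (nabla2 c g (nabla_end c A)).
Local Notation at_ q t := (fun d e => t d e q).

Lemma nabla_end_eq a Y Z p : U p -> (forall q, U q -> Y q = Z q) -> D a Y p = D a Z p.
Proof. by move=> hp E; rewrite /nabla_end (pdM_eq Uo Uc a hp E) E. Qed.

Lemma smooth_nabla_end a Y : smoothM c U Y -> smoothM c U (D a Y).
Proof.
move=> HY; apply: smoothMB => //; last exact: smoothM_mul.
by apply: smoothMD => //; [exact: smoothM_pdM | exact: smoothM_mul].
Qed.

Lemma nabla_endD a Y Z p : smoothM c U Y -> smoothM c U Z -> U p ->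
  D a (fun q => Y q + Z q) p = D a Y p + D a Z p.
Proof.
move=> HY HZ hp; rewrite /nabla_end (pdMD Uo Uc) // mulmxDr mulmxDl.
by apply/matrixP => i j; rewrite !(addmxE, oppmxE); ring.
Qed.

Lemma nabla_endN a Y p : smoothM c U Y -> U p -> D a (fun q => - Y q) p = - D a Y p.
Proof.
move=> HY hp; rewrite /nabla_end (pdMN Uo Uc) // mulmxN mulNmx.
by rewrite !opprD.
Qed.

Lemma nabla_end_scale a (k : X -> K) Y p : smoothK c U k -> smoothM c U Y -> U p ->
  D a (fun q => k q *: Y q) p = pdK c a k p *: Y p + k p *: D a Y p.
Proof.
move=> Hk HY hp; rewrite /nabla_end (pdM_scale Uo Uc) // -scalemxAr -scalemxAl.
by rewrite scalerBr scalerDr !addrA.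
Qed.

Lemma nabla_end_sum a (k : 'I_6 -> X -> K) (Y : 'I_6 -> X -> 'M[K]_r) p :
  (forall f, smoothK c U (k f)) -> (forall f, smoothM c U (Y f)) -> U p ->
  D a (fun q => \sum_f k f q *: Y f q) p =
  \sum_f (pdK c a (k f) p *: Y f p) + \sum_f (k f p *: D a (Y f) p).
Proof.
move=> Hk HY hp; rewrite /nabla_end (pdM_sum Uo Uc) // => [|f]; last exact: smoothM_scale.
rewrite mulmx_sumr mulmx_suml -sumrN -!big_split /=; apply: eq_bigr => f _.
by rewrite -nabla_end_scale // /nabla_end.
Qed.

(** The trace of endomorphisms is parallel, as commutators are trace-free. *)
Lemma tr_nabla_end a Y p : smoothM c U Y -> U p ->
  \tr (D a Y p) = pdK c a (fun q => \tr (Y q)) p.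
Proof.
move=> HY hp; rewrite /nabla_end linearB linearD /= [X in _ + X - _]mxtrace_mulC addrK.
by rewrite (pdK_tr Uo Uc).
Qed.

Lemma nabla_endM a Y Z p : smoothM c U Y -> smoothM c U Z -> U p ->
  D a (fun q => Y q *m Z q) p = D a Y p *m Z p + Y p *m D a Z p.
Proof.
move=> HY HZ hp; rewrite /nabla_end (pdM_mul Uo Uc) //.
rewrite !mulmxBl !mulmxBr !mulmxDl !mulmxDr !mulmxA.
move: (pdM c a Y p *m Z p) (Y p *m pdM c a Z p) (A a p *m Y p *m Z p)
  (Y p *m A a p *m Z p) (Y p *m Z p *m A a p) => y1 y2 y3 y4 y5.
by apply/matrixP => i j; rewrite !(addmxE, oppmxE); ring.
Qed.

Lemma nabla_sec_frame a j q : U q ->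
  nabla_sec c A a (fun=> delta_mx j 0) q = A a q *m delta_mx j 0.
Proof. by move=> hq; rewrite /nabla_sec (pdM_cst Uc) // add0r. Qed.

Lemma curvE a b q : U q -> F a b q = pdM c a (A b) q - pdM c b (A a) q
  + (A a q *m A b q - A b q *m A a q).
Proof.
move=> hq.
have E x y j : nabla_nabla_sec c g A x y (fun=> delta_mx j 0) q =
    (pdM c x (A y) q + A x q *m A y q) *m delta_mx j 0
    - \sum_f christoffel c g f x y q *:' (A f q *m delta_mx j 0).
  rewrite /nabla_nabla_sec /nabla1; congr (_ - _); last first.
    by apply: eq_bigr => f _; rewrite nabla_sec_frame.
  rewrite {1}/nabla_sec nabla_sec_frame //.
  rewrite (pdM_eq Uo Uc (Z := fun q => A y q *m delta_mx j 0) x hq) => [|q' hq']; last first.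
    exact: nabla_sec_frame.
  rewrite (pdM_mul Uo Uc) //; last exact: smoothM_cst.
  by rewrite (pdM_cst Uc) // mulmx0 addr0 mulmxA mulmxDl.
apply/matrixP => i j; rewrite [LHS]mxE; cbv zeta.
have G : \sum_f christoffel c g f b a q *:' (A f q *m delta_mx j 0) =
    \sum_f christoffel c g f a b q *:' (A f q *m delta_mx j 0) :> 'cV_r.
  by apply: eq_bigr => f _; rewrite (christoffelC Uo Uc).
rewrite !E G opprB addrA subrK -mulmxBl.
rewrite -colE [LHS]mxE !(addmxE, oppmxE).
by ring.
Qed.

Lemma smooth_curv a b : smoothM c U (F a b).
Proof.
apply: (smoothM_eq Uo Uc (Y := fun q => pdM c a (A b) q - pdM c b (A a) q
  + (A a q *m A b q - A b q *m A a q))) => [q hq|]; first by rewrite curvE.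
apply: smoothMD => //; apply: smoothMB => //; try exact: smoothM_pdM.
  exact: smoothM_mul.
exact: smoothM_mul.
Qed.

Lemma curvC a b q : U q -> F a b q = - F b a q.
Proof. by move=> hq; rewrite !curvE // opprD !opprB. Qed.

Lemma nabla_end_comm a b Y p : smoothM c U Y -> U p ->
  D a (D b Y) p - D b (D a Y) p = F a b p *m Y p - Y p *m F a b p.
Proof.
move=> HY hp.
have E x y : D x (D y Y) p = pdM c x (pdM c y Y) p
    + (pdM c x (A y) p *m Y p + A y p *m pdM c x Y p)
    - (pdM c x Y p *m A y p + Y p *m pdM c x (A y) p)
    + A x p *m (pdM c y Y p + A y p *m Y p - Y p *m A y p)
    - (pdM c y Y p + A y p *m Y p - Y p *m A y p) *m A x p.
  rewrite {1}/nabla_end; congr (_ + _ - _); rewrite /nabla_end.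
  have S1 := smoothM_mul Uo Uc (AS y) HY; have S2 := smoothM_mul Uo Uc HY (AS y).
  have S0 := smoothM_pdM Uo Uc y HY.
  rewrite (pdMB Uo Uc x (smoothMD Uo Uc S0 S1) S2 hp) (pdMD Uo Uc x S0 S1 hp).
  by rewrite (pdM_mul Uo Uc x (AS y) HY hp) (pdM_mul Uo Uc x HY (AS y) hp).
exact: (curvature_identity (E a b) (E b a) (pdM_pdMC Uo Uc a b HY hp) (curvE a b hp)).
Qed.

Lemma curv_bianchi a b e p : U p -> D a (F b e) p + D b (F e a) p + D e (F a b) p = 0.
Proof.
move=> hp.
have E x y z : D x (F y z) p = pdM c x (pdM c y (A z)) p - pdM c x (pdM c z (A y)) p
    + (pdM c x (A y) p *m A z p + A y p *m pdM c x (A z) p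
      - (pdM c x (A z) p *m A y p + A z p *m pdM c x (A y) p))
    + A x p *m (pdM c y (A z) p - pdM c z (A y) p + (A y p *m A z p - A z p *m A y p))
    - (pdM c y (A z) p - pdM c z (A y) p + (A y p *m A z p - A z p *m A y p)) *m A x p.
  rewrite /nabla_end (curvE y z hp); congr (_ + _ - _).
  rewrite (pdM_eq Uo Uc x hp (curvE y z)).
  have S1 := smoothM_mul Uo Uc (AS y) (AS z); have S2 := smoothM_mul Uo Uc (AS z) (AS y).
  have S3 := smoothM_pdM Uo Uc y (AS z); have S4 := smoothM_pdM Uo Uc z (AS y).
  rewrite (pdMD Uo Uc x (smoothMB Uo Uc S3 S4) (smoothMB Uo Uc S1 S2) hp).
  rewrite (pdMB Uo Uc x S3 S4 hp) (pdMB Uo Uc x S1 S2 hp).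
  by rewrite (pdM_mul Uo Uc x (AS y) (AS z) hp) (pdM_mul Uo Uc x (AS z) (AS y) hp).
rewrite (E a b e) (E b e a) (E e a b).
apply: (@bianchi_identity _ _ _ (fun x y z => pdM c x (pdM c y (A z)) p)
  (fun x y => pdM c x (A y) p) (fun x => A x p)) => x y z.
exact: (pdM_pdMC Uo Uc x y (AS z) hp).
Qed.

Lemma gupE a b q : (gup g a b q)%:A = V q a b :> K.
Proof. by rewrite /= -map_invmx mxE. Qed.

Lemma gammaKE f a b q : (christoffel c g f a b q)%:A = Gm a q f b :> K.
Proof. by rewrite mxE. Qed.

Lemma nabla2E a t d e q : N a t d e q =
  D a (t d e) q - lmulT (Gm a q) (at_ q t) d e - rmulT (Gm a q) (at_ q t) d e.
Proof. by congr (_ - _ - _); apply: eq_bigr => f _; rewrite /rscale mxE. Qed.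

Lemma smooth_lmulT (G : X -> 'M[K]_6) t d e : smoothM c U G ->
  (forall d e, smoothM c U (t d e)) ->
  smoothM c U (fun q => lmulT (G q) (at_ q t) d e).
Proof. by move=> HG Ht; apply: smoothM_sum => // f; apply: smoothM_scale. Qed.

Lemma smooth_rmulT (G : X -> 'M[K]_6) t d e : smoothM c U G ->
  (forall d e, smoothM c U (t d e)) ->
  smoothM c U (fun q => rmulT (G q) (at_ q t) d e).
Proof. by move=> HG Ht; apply: smoothM_sum => // f; apply: smoothM_scale. Qed.

Lemma nabla_end_lmulT a (G : X -> 'M[K]_6) t d e p : smoothM c U G ->
  (forall d e, smoothM c U (t d e)) -> U p ->
  D a (fun q => lmulT (G q) (at_ q t) d e) p =
  lmulT (pdM c a G p) (at_ p t) d e + lmulT (G p) (fun d e => D a (t d e) p) d e.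
Proof.
move=> HG Ht hp; rewrite (nabla_end_sum a (fun f => HG f d) (fun f => Ht f e) hp).
by congr (_ + _); apply: eq_bigr => f _; rewrite pdME.
Qed.

Lemma nabla_end_rmulT a (G : X -> 'M[K]_6) t d e p : smoothM c U G ->
  (forall d e, smoothM c U (t d e)) -> U p ->
  D a (fun q => rmulT (G q) (at_ q t) d e) p =
  rmulT (pdM c a G p) (at_ p t) d e + rmulT (G p) (fun d e => D a (t d e) p) d e.
Proof.
move=> HG Ht hp; rewrite (nabla_end_sum a (fun f => HG f e) (fun f => Ht d f) hp).
by congr (_ + _); apply: eq_bigr => f _; rewrite pdME.
Qed.

Let GS a : smoothM c U (Gm a) := smooth_gammaK Uo Uc gS gU a.
Let VS : smoothM c U V := smooth_invmetricK Uo Uc gS gU.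

Lemma smooth_nabla2 a t d e : (forall d e, smoothM c U (t d e)) -> smoothM c U (N a t d e).
Proof.
move=> Ht; apply: (smoothM_eq Uo Uc (Y := fun q => D a (t d e) q
  - lmulT (Gm a q) (at_ q t) d e - rmulT (Gm a q) (at_ q t) d e)).
  by move=> q _; rewrite nabla2E.
apply: smoothMB => //; last exact: smooth_rmulT.
by apply: smoothMB => //; [exact: smooth_nabla_end | exact: smooth_lmulT].
Qed.

Lemma ricci_identity a b t d e p : (forall d e, smoothM c U (t d e)) -> U p ->
  N a (N b t) d e p - N b (N a t) d e p =
  F a b p *m t d e p - t d e p *m F a b p
    - lmulT (riemK c K g a b p) (at_ p t) d e - rmulT (riemK c K g a b p) (at_ p t) d e.
Proof.
move=> Ht hp.
have E x y : N x (N y t) d e p = D x (D y (t d e)) p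
    - (lmulT (pdM c x (Gm y) p) (at_ p t) d e + lmulT (Gm y p) (fun d e => D x (t d e) p) d e)
    - (rmulT (pdM c x (Gm y) p) (at_ p t) d e + rmulT (Gm y p) (fun d e => D x (t d e) p) d e)
    - lmulT (Gm x p) (fun d e => D y (t d e) p
        - lmulT (Gm y p) (at_ p t) d e - rmulT (Gm y p) (at_ p t) d e) d e
    - rmulT (Gm x p) (fun d e => D y (t d e) p
        - lmulT (Gm y p) (at_ p t) d e - rmulT (Gm y p) (at_ p t) d e) d e.
  rewrite [LHS]nabla2E; congr (_ - _ - _).
  - rewrite (nabla_end_eq x hp (fun q _ => nabla2E y t d e q)).
    have S1 := smooth_lmulT d e (GS y) Ht; have S2 := smooth_rmulT d e (GS y) Ht.
    have S0 := smooth_nabla_end y (Ht d e).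
    rewrite (nabla_endD x (smoothMB Uo Uc S0 S1) (smoothMN Uo Uc S2) hp).
    rewrite (nabla_endD x S0 (smoothMN Uo Uc S1) hp) (nabla_endN x S1 hp) (nabla_endN x S2 hp).
    by rewrite (nabla_end_lmulT x d e (GS y) Ht hp) (nabla_end_rmulT x d e (GS y) Ht hp).
  - by apply: lmulT_eq => *; rewrite nabla2E.
  - by apply: rmulT_eq => *; rewrite nabla2E.
apply: etrans (congr2 (fun y z => y - z) (E a b) (E b a)) _.
by apply: etrans (commutator_identity _ _ _ _ _ _ _ _ _ _ _) _; rewrite nabla_end_comm.
Qed.

Lemma smooth_raise2 t d e : (forall d e, smoothM c U (t d e)) ->
  smoothM c U (fun q => raise2 (V q) (at_ q t) d e).
Proof.
move=> Ht; exact: (smooth_lmulT (t := fun d e q => rmulT (V q) (at_ q t) d e) d e VS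
  (fun d e => smooth_rmulT d e VS Ht)).
Qed.

(** The inverse metric is parallel. *)
Lemma nabla_end_raise2 a t d e p : (forall d e, smoothM c U (t d e)) -> U p ->
  D a (fun q => raise2 (V q) (at_ q t) d e) p =
  raise2 (V p) (at_ p (N a t)) d e - lmulT (Gm a p)^T (raise2 (V p) (at_ p t)) d e
    - rmulT (Gm a p)^T (raise2 (V p) (at_ p t)) d e.
Proof.
move=> Ht hp.
apply: etrans (nabla_end_lmulT a (t := fun d e q => rmulT (V q) (at_ q t) d e) d e VS
  (fun d e => smooth_rmulT d e VS Ht) hp) _.
have E d' e' := nabla_end_rmulT a d' e' VS Ht hp.
rewrite (lmulT_eq _ _ _ E).
rewrite (raise2_identity _ _ _ _ (invmetricK_tr K gT hp) (pdM_invmetricK K Uo Uc gS gT gU a hp)).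
by rewrite [in RHS](raise2_eq _ d e (fun d e => nabla2E a t d e p)).
Qed.

Lemma pdK_contr a s t p : (forall d e, smoothM c U (s d e)) ->
  (forall d e, smoothM c U (t d e)) -> U p ->
  pdK c a (fun q => contr (at_ q s) (at_ q t)) p =
  contr (fun d e => D a (s d e) p) (at_ p t) + contr (at_ p s) (fun d e => D a (t d e) p).
Proof.
move=> Hs Ht hp.
have S d e : smoothM c U (fun q => s d e q *m t d e q) by exact: smoothM_mul.
have S1 d e : smoothK c U (fun q => \tr (s d e q *m t d e q)) by exact: smoothK_tr.
rewrite (pdK_sum Uo Uc a _ _ (fun d => smoothK_sum Uo Uc _ _ (S1 d)) hp).
rewrite -big_split; apply: eq_bigr => d _.
rewrite (pdK_sum Uo Uc a _ _ (S1 d) hp) -big_split; apply: eq_bigr => e _ /=.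
by rewrite -tr_nabla_end // nabla_endM // linearD.
Qed.

(** The Leibniz rule for the metric pairing of two bundle-valued 2-tensors. This is
    where metric compatibility enters the Laplacian of [F^ab F_ab]. *)
Lemma pdK_contr_raise2 a s t p : (forall d e, smoothM c U (s d e)) ->
  (forall d e, smoothM c U (t d e)) -> U p ->
  pdK c a (fun q => contr (raise2 (V q) (at_ q s)) (at_ q t)) p =
  contr (raise2 (V p) (at_ p (N a s))) (at_ p t) +
  contr (raise2 (V p) (at_ p s)) (at_ p (N a t)).
Proof.
move=> Hs Ht hp.
apply: etrans (pdK_contr a (s := fun d e q => raise2 (V q) (at_ q s) d e)
  (fun d e => smooth_raise2 d e Hs) Ht hp) _.
rewrite (contr_eq (fun d e => nabla_end_raise2 a d e Hs hp) (fun _ _ => erefl)).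
rewrite contr_leibniz_identity; congr (_ + _); apply: contr_eq => // d e.
by rewrite nabla2E.
Qed.

(** The components [nabla_a nabla_b F_de] of the second covariant derivative:
    [N a (N b F)] leaves [b] as a label, and the sum corrects for it as a tensor
    index. *)
Definition hess_curv a b d e p : 'M[K]_r :=
  N a (N b F) d e p - \sum_f Gm a p f b *: N f F d e p.

Lemma curv_upE a b q : U q -> curv_up c g A a b q = raise2 (V q) (at_ q F) a b.
Proof.
move=> hq; have VT := invmetricK_tr K gT hq.
rewrite /curv_up /raise2 /lmulT /rmulT; apply: eq_bigr => e _.
rewrite scaler_sumr; apply: eq_bigr => f _; rewrite /rscale scalerA.
by rewrite -[in RHS]VT !mxE -!gupE -scalerAl mul1r scalerA.
Qed.

Lemma gammaK_sym d f a p : U p -> Gm d p f a = Gm a p f d.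
Proof. by move=> hp; rewrite !mxE (christoffelC Uo Uc). Qed.

Lemma smooth_nabla_curv a d e : smoothM c U (N a F d e).
Proof. exact: smooth_nabla2 smooth_curv. Qed.

Lemma nabla2_antisym a t d e q : (forall d e, smoothM c U (t d e)) ->
  (forall d e q, U q -> t d e q = - t e d q) -> U q -> N a t d e q = - N a t e d q.
Proof.
move=> Ht tC hq.
have E d' e' : lmulT (Gm a q) (at_ q t) d' e' = - rmulT (Gm a q) (at_ q t) e' d'.
  by rewrite -sumrN; apply: eq_bigr => f _; rewrite tC // scalerN.
have DE := etrans (nabla_end_eq a hq (tC d e)) (nabla_endN a (Ht e d) hq).
apply: etrans (nabla2E a t d e q) (etrans (antisym_identity DE (E d e) (E e d)) _).
by rewrite nabla2E.
Qed.

(** The Christoffel corrections cancel in pairs, by the symmetry of the Christoffel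
    symbols and the skewness of [F]. *)
Lemma nabla_curv_bianchi d a b q : U q -> N d F a b q + N a F b d q + N b F d a q = 0.
Proof.
move=> hq.
have E x y z : lmulT (Gm x q) (at_ q F) y z = - rmulT (Gm y q) (at_ q F) z x.
  rewrite -sumrN; apply: eq_bigr => f _.
  by rewrite (gammaK_sym x f y hq) (curvC f z hq) scalerN.
apply: etrans (congr2 +%R (congr2 +%R (nabla2E d F a b q) (nabla2E a F b d q))
  (nabla2E b F d a q)) _.
exact (etrans (cyclic3_identity (D d (F a b) q) (D a (F b d) q) (D b (F d a) q)
  (E d a b) (E a b d) (E b d a)) (curv_bianchi d a b hq)).
Qed.

Lemma hess_curvC a b d e p : U p -> hess_curv a b d e p = - hess_curv a b e d p.
Proof.
move=> hp; rewrite /hess_curv.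
have C x d' e' q : U q -> N x F d' e' q = - N x F e' d' q.
  by apply: nabla2_antisym => //; [exact: smooth_curv | move=> *; exact: curvC].
have S : \sum_f Gm a p f b *: N f F d e p = - \sum_f Gm a p f b *: N f F e d p.
  by rewrite -sumrN; apply: eq_bigr => f _; rewrite (C f d e p hp) scalerN.
have T := nabla2_antisym a d e (fun d e => smooth_nabla_curv b d e) (C b) hp.
exact (etrans (congr2 (fun x y => x - y) T S) (esym (opprD _ _))).
Qed.

Lemma hess_curv_bianchi a d b e p : U p ->
  hess_curv a d b e p + hess_curv a b e d p + hess_curv a e d b p = 0.
Proof.
move=> hp.
have E x y z : hess_curv a x y z p = D a (N x F y z) p
    - (lmulT (Gm a p) (at_ p (N x F)) y z + rmulT (Gm a p) (at_ p (N x F)) y z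
       + \sum_f Gm a p f x *: N f F y z p).
  by rewrite /hess_curv [X in X - _]nabla2E !opprD !addrA.
have L := cyclic_identity (t := fun x y z => N x F y z p) (Gm a p) d b e
  (fun x y z => nabla_curv_bianchi x y z hp).
have S := smooth_nabla_curv.
have Z : D a (N d F b e) p + D a (N b F e d) p + D a (N e F d b) p = 0.
  rewrite -(nabla_endD a (S d b e) (S b e d) hp).
  rewrite -(nabla_endD a (smoothMD Uo Uc (S d b e) (S b e d)) (S e d b) hp).
  rewrite (nabla_end_eq (Z := fun=> 0) a hp (fun q hq => nabla_curv_bianchi d b e hq)).
  by rewrite /nabla_end (pdM_cst Uc) // mulmx0 mul0mx addr0 subr0.
exact: sub3_identity (E d b e) (E b e d) (E e d b) Z L.
Qed.

(** The correction for the index [b] is symmetric because the connection is free of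
    torsion, so only the Ricci identity for 2-tensors remains. *)
Lemma hess_curv_comm a b d e p : U p -> hess_curv a b d e p - hess_curv b a d e p =
  F a b p *m F d e p - F d e p *m F a b p
    - lmulT (riemK c K g a b p) (at_ p F) d e - rmulT (riemK c K g a b p) (at_ p F) d e.
Proof.
move=> hp.
have S : \sum_f Gm a p f b *: N f F d e p = \sum_f Gm b p f a *: N f F d e p.
  by apply: eq_bigr => f _; rewrite (gammaK_sym a f b hp).
exact (etrans (subr_common (N a (N b F) d e p) (N b (N a F) d e p) S)
  (ricci_identity a b d e smooth_curv hp)).
Qed.

Lemma tr_curv_sq q : U q ->
  \tr (curv_sq c g A q) = contr (raise2 (V q) (at_ q F)) (at_ q F).
Proof.
move=> hq; rewrite linear_sum; apply: eq_bigr => a _; rewrite linear_sum.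
by apply: eq_bigr => b _; rewrite curv_upE.
Qed.

Lemma smooth_curv_sq : smoothM c U (curv_sq c g A).
Proof.
apply: (smoothM_eq Uo Uc (Y := fun q => \sum_a \sum_b
  raise2 (V q) (at_ q F) a b *m F a b q)) => [q hq|].
  by apply: eq_bigr => a _; apply: eq_bigr => b _; rewrite curv_upE.
do 2![apply: smoothM_sum => // ?]; apply: smoothM_mul => //.
  exact: smooth_raise2 smooth_curv.
exact: smooth_curv.
Qed.

Lemma tr_nabla_curv_sq b q : U q -> \tr (D b (curv_sq c g A) q) =
  contr (raise2 (V q) (at_ q F)) (at_ q (N b F)) +
  contr (raise2 (V q) (at_ q F)) (at_ q (N b F)).
Proof.
move=> hq; rewrite (tr_nabla_end b smooth_curv_sq hq).
rewrite (pdK_eq Uo Uc b hq tr_curv_sq) pdK_contr_raise2 //; try exact: smooth_curv.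
by rewrite (contr_raise2 _ _ (invmetricK_tr K gT hq)).
Qed.

Lemma smoothK_contr s t : (forall d e, smoothM c U (s d e)) ->
  (forall d e, smoothM c U (t d e)) -> smoothK c U (fun q => contr (at_ q s) (at_ q t)).
Proof.
by move=> Hs Ht; do 2![apply: smoothK_sum => // ?]; apply: smoothK_tr => //;
  exact: smoothM_mul.
Qed.

Lemma tr_nabla_nabla_curv_sq a b p : U p -> \tr (D a (D b (curv_sq c g A)) p) =
  2 * (contr (raise2 (V p) (at_ p (N a F))) (at_ p (N b F)) +
       contr (raise2 (V p) (at_ p F)) (at_ p (N a (N b F)))).
Proof.
move=> hp; rewrite (tr_nabla_end a (smooth_nabla_end b smooth_curv_sq) hp).
rewrite (pdK_eq Uo Uc a hp (fun q hq => tr_nabla_curv_sq b hq)).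
have S := smooth_nabla_curv b.
have SK := smoothK_contr (s := fun d e q => raise2 (V q) (at_ q F) d e)
  (fun d e => smooth_raise2 d e smooth_curv) S.
rewrite (pdKD Uo Uc a SK SK hp) (pdK_contr_raise2 a smooth_curv S hp).
by rewrite mulr_natl mulr2n.
Qed.

Lemma tr_laplacian_curv_sq p : U p -> \tr (laplacian c g A (curv_sq c g A) p) =
  2 * (\sum_a \sum_b V p a b * contr (raise2 (V p) (at_ p (N a F))) (at_ p (N b F))) +
  2 * \sum_a \sum_b V p a b *
    contr (raise2 (V p) (at_ p F)) (fun d e => hess_curv a b d e p).
Proof.
move=> hp; rewrite /laplacian linear_sum !mulr_sumr -big_split; apply: eq_bigr => a _.
rewrite linear_sum !mulr_sumr -big_split; apply: eq_bigr => b _ /=.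
rewrite /rscale linearZ /= gupE.
have -> : contr (raise2 (V p) (at_ p F)) (fun d e => hess_curv a b d e p) =
    contr (raise2 (V p) (at_ p F)) (at_ p (N a (N b F))) -
    \sum_f Gm a p f b * contr (raise2 (V p) (at_ p F)) (at_ p (N f F)).
  by rewrite -contr_sumZr -contrNr -contrDr.
have -> : \tr (nabla1 c g D a (fun b' => D b' (curv_sq c g A)) b p) =
    2 * (contr (raise2 (V p) (at_ p (N a F))) (at_ p (N b F)) +
       contr (raise2 (V p) (at_ p F)) (at_ p (N a (N b F))))
    - 2 * \sum_f Gm a p f b * contr (raise2 (V p) (at_ p F)) (at_ p (N f F)).
  rewrite /nabla1 linearB /= tr_nabla_nabla_curv_sq //; congr (_ - _).
  rewrite linear_sum mulr_sumr; apply: eq_bigr => f _ /=.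
  rewrite /rscale linearZ /= gammaKE (tr_nabla_curv_sq f hp).
  by rewrite -mulr2n -[_ *+ 2]mulr_natl mulrCA.
exact: laplacian_identity.
Qed.

Lemma nabla_end_bigsum a (Y : 'I_6 -> X -> 'M[K]_r) p :
  (forall f, smoothM c U (Y f)) -> U p ->
  D a (fun q => \sum_f Y f q) p = \sum_f D a (Y f) p.
Proof.
move=> HY hp; rewrite /nabla_end (pdM_sum Uo Uc) //.
by rewrite mulmx_sumr mulmx_suml -sumrN -!big_split.
Qed.

Lemma nabla_end_contrS a t p : (forall d e, smoothM c U (t d e)) -> U p ->
  D a (fun q => contrS (V q) (at_ q t)) p =
  contrS (pdM c a V p) (at_ p t) + contrS (V p) (fun d e => D a (t d e) p).
Proof.
move=> Ht hp.
have S d : smoothM c U (fun q => \sum_e V q d e *: t d e q).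
  by apply: smoothM_sum => // e; apply: smoothM_scale => //; exact: VS.
rewrite (nabla_end_bigsum a S hp) -big_split; apply: eq_bigr => d _ /=.
rewrite (nabla_end_sum a (VS d) (Ht d) hp).
by congr (_ + _); apply: eq_bigr => e _; rewrite pdME.
Qed.

Lemma currentE b q : current c g A b q = contrS (V q) (fun x e => N x F e b q).
Proof. by do 2![apply: eq_bigr => ? _]; rewrite /rscale gupE. Qed.

(** The current is a divergence, and contraction with the parallel inverse metric
    commutes with the derivative. *)
Lemma nabla_currentE a b p : U p -> nabla_current c g A a b p =
  contrS (V p) (fun x e => hess_curv a x e b p).
Proof.
move=> hp; rewrite /nabla_current /nabla1.
have S x e : smoothM c U (N x F e b) by exact: smooth_nabla_curv.
have E1 : D a (current c g A b) p =
    - contrS (V p) (lmulT (Gm a p) (fun x e => N x F e b p))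
    - contrS (V p) (rmulT (Gm a p) (fun x e => N x F e b p))
    + contrS (V p) (fun x e => D a (N x F e b) p).
  rewrite (nabla_end_eq a hp (fun q _ => currentE b q)).
  rewrite (nabla_end_contrS a S hp) (pdM_invmetricK K Uo Uc gS gT gU a hp).
  rewrite contrSDl !contrSNl trmx_mul (invmetricK_tr K gT hp).
  by rewrite contrS_mull contrS_mulr.
have E2 : \sum_f christoffel c g f a b p *:' current c g A f p =
    contrS (V p) (fun x e => \sum_f Gm a p f b *: N x F e f p).
  rewrite -contrS_sum; apply: eq_bigr => f _.
  by rewrite currentE /rscale mxE.
apply: etrans (congr2 (fun y z => y - z) E1 E2) _.
apply: etrans (contrS_combine _ _ _ _ _) (contrS_eq _ _) => x e.
exact (current_identity (nabla2E a (N x F) e b p) erefl).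
Qed.

Definition schoutenK p : 'M[K]_6 := \matrix_(a, e) (schouten c g a e p)%:A.
Definition weylK p a b d e : K := (weyl c g a b d e p)%:A.

Lemma algM (x y : R) : (x * y)%:A = x%:A * y%:A :> K.
Proof. by rewrite -scalerAl mul1r scalerA. Qed.

Lemma alg_sum (I : Type) (l : seq I) (h : I -> R) :
  (\sum_(i <- l) h i)%:A = \sum_(i <- l) (h i)%:A :> K.
Proof. by rewrite scaler_suml. Qed.

Lemma K_neq0_2 : (2 : K) != 0.
Proof.
have -> : (2 : K) = (2 : R)%:A by rewrite scaler_nat.
by rewrite scaler_eq0 oner_eq0 orbF pnatr_eq0.
Qed.

Lemma riemKC a b p : riemK c K g a b p = - riemK c K g b a p.
Proof. by rewrite /riemK opprD !opprB. Qed.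

Lemma riemK_ricci a e p : U p -> \sum_b riemK c K g a b p b e =
  - (4 * schoutenK p a e + (schouten_trace c g p)%:A * metricK K g p a e).
Proof.
move=> hp.
transitivity ((- ric c g a e p)%:A : K).
  rewrite /ric opprK alg_sum; apply: eq_bigr => b _.
  by rewrite -(riemE K Uo Uc gS gT gU).
rewrite (ric_schouten c a e (gT hp) (gU hp)) !mxE /= scaleNr scalerDl !algM.
congr (- (_ * _ + _)); last by rewrite mulrC.
by rewrite (_ : 6 - 2 = 4%:R :> R) ?scaler_nat //; ring.
Qed.

Lemma riemK_weyl a b d e p : U p -> (metricK K g p *m riemK c K g a b p) d e =
  weylK p a b d e + (metricK K g p a d * schoutenK p b e - metricK K g p b d * schoutenK p a e
    + metricK K g p b e * schoutenK p a d - metricK K g p a e * schoutenK p b d).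
Proof.
move=> hp.
transitivity ((riem_low c g a b d e p)%:A : K).
  rewrite /riem_low alg_sum mxE; apply: eq_bigr => h _.
  by rewrite algM -(riemE K Uo Uc gS gT gU) // mxE.
rewrite /weylK /weyl ![in RHS]mxE /= -!algM -!scalerBl -!scalerDl -!scalerBl -scalerDl.
by congr (_ *: _); rewrite subrK.
Qed.

Lemma schouten_mixE a e p : U p ->
  (schouten_mix c g a e p)%:A = (V p *m (schoutenK p)^T) e a :> K.
Proof.
move=> hp; rewrite /schouten_mix alg_sum [RHS]mxE; apply: eq_bigr => f _.
by rewrite algM gupE !mxE.
Qed.

Lemma schouten_termE p : U p ->
  \tr (\sum_a \sum_b \sum_e curv_up c g A a b p *m (schouten_mix c g a e p *:' F b e p)) =
  - contr (raise2 (V p) (at_ p F)) (lmulT (V p *m (schoutenK p)^T) (at_ p F)).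
Proof.
move=> hp; rewrite -contrNr linear_sum; apply: eq_bigr => a _.
rewrite linear_sum; apply: eq_bigr => b _ /=.
rewrite -mulmx_sumr (curv_upE a b hp); congr (\tr (_ *m _)).
rewrite -sumrN; apply: eq_bigr => e _.
by rewrite /rscale (schouten_mixE a e hp) (curvC b e hp) scalerN.
Qed.

Lemma weyl_termE p : U p ->
  \tr (\sum_a \sum_b \sum_e \sum_f
    curv_up c g A a b p *m (weyl_mix c g e a b f p *:' F f e p)) =
  contr (raise2 (V p) (at_ p F))
    (fun a b => \sum_d \sum_e weylK p d a b e *: raise2 (V p) (at_ p F) e d).
Proof.
move=> hp; rewrite linear_sum; apply: eq_bigr => a _.
rewrite linear_sum; apply: eq_bigr => b _ /=.
transitivity (\tr (curv_up c g A a b p *m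
    (\sum_e \sum_f weyl_mix c g e a b f p *:' F f e p))).
  by rewrite mulmx_sumr; congr (\tr _); apply: eq_bigr => e _; rewrite mulmx_sumr.
rewrite (curv_upE a b hp); congr (\tr (_ *m _)).
transitivity (\sum_e \sum_f \sum_h \sum_k
    (V p e h * V p f k * weylK p h a b k) *: F f e p).
  apply: eq_bigr => e _; apply: eq_bigr => f _.
  rewrite /rscale /weyl_mix alg_sum scaler_suml; apply: eq_bigr => h _.
  rewrite alg_sum scaler_suml; apply: eq_bigr => k _.
  by rewrite !algM !gupE.
rewrite sum_exchange4; apply: eq_bigr => h _; apply: eq_bigr => k _.
rewrite /raise2 /lmulT exchange_big scaler_sumr; apply: eq_bigr => f _ /=.
rewrite /rmulT !scaler_sumr; apply: eq_bigr => e _.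
by rewrite !scalerA; congr (_ *: _); ring.
Qed.

Lemma cubic_termE p : U p ->
  \tr (\sum_a \sum_b \sum_e curv_up c g A a b p *m curv_mix c g A e a p *m F b e p) =
  contr (raise2 (V p) (at_ p F))
    (fun a b => contrS (V p) (fun d e => F d a p *m F b e p)).
Proof.
move=> hp; rewrite linear_sum; apply: eq_bigr => a _.
rewrite linear_sum; apply: eq_bigr => b _ /=.
transitivity (\tr (curv_up c g A a b p *m
    (\sum_e curv_mix c g A e a p *m F b e p))).
  by rewrite mulmx_sumr; congr (\tr _); apply: eq_bigr => e _; rewrite mulmxA.
rewrite (curv_upE a b hp); congr (\tr (_ *m _)).
rewrite -(contrS_swap (invmetricK_tr K gT hp)); apply: eq_bigr => e _.
rewrite /curv_mix mulmx_suml; apply: eq_bigr => f _.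
by rewrite /rscale gupE -scalemxAl.
Qed.

Lemma nabla_curv_up_termE p : U p ->
  \tr (\sum_e \sum_a \sum_b nabla_curv_up c g A e a b p *m nabla_curv c g A e a b p) =
  \sum_a \sum_b V p a b * contr (raise2 (V p) (at_ p (N a F))) (at_ p (N b F)).
Proof.
move=> hp; have VE a b : V p a b = V p b a.
  by rewrite -[in LHS](invmetricK_tr K gT hp) mxE.
have E e a b : nabla_curv_up c g A e a b p =
    \sum_f V p e f *: raise2 (V p) (at_ p (N f F)) a b.
  apply: eq_bigr => f _; rewrite /raise2 /lmulT scaler_sumr; apply: eq_bigr => h _.
  rewrite /rmulT !scaler_sumr; apply: eq_bigr => k _.
  by rewrite (VE h a) (VE k b) /rscale !algM !gupE !scalerA mulrA.
rewrite [RHS]exchange_big linear_sum /=; apply: eq_bigr => e _.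
have CS : \sum_f V p f e * contr (raise2 (V p) (at_ p (N f F))) (at_ p (N e F)) =
   contr (at_ p (N e F)) (fun a b => \sum_f V p e f *: raise2 (V p) (at_ p (N f F)) a b).
  rewrite contr_sumZr; apply: eq_bigr => f _.
  by rewrite contrC (VE f e).
apply: etrans (esym (etrans CS (contrC _ _))).
rewrite linear_sum; apply: eq_bigr => a _.
by rewrite linear_sum; apply: eq_bigr => b _; rewrite E.
Qed.

Lemma nabla_current_termE p : U p ->
  \tr (\sum_a \sum_b curv_up c g A a b p *m nabla_current c g A a b p) =
  contr (raise2 (V p) (at_ p F))
    (fun a b => contrS (V p) (fun x e => hess_curv a x e b p)).
Proof.
move=> hp; rewrite linear_sum; apply: eq_bigr => a _; rewrite linear_sum.
by apply: eq_bigr => b _; rewrite (curv_upE a b hp) (nabla_currentE a b hp).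
Qed.

Theorem anomaly_energy p : U p -> anomaly c g A p = energy_ren c g A p.
Proof.
move=> hp.
have VT := invmetricK_tr K gT hp; have GT := metricK_tr K gT hp.
have VG : V p *m metricK K g p = 1%:M by rewrite mulVmx // (metricK_unit K gU hp).
have B := bochner (V p) (F := at_ p F) (Rm := fun a b => riemK c K g a b p)
  (fun a b => curvC a b hp) (H := fun a b d e => hess_curv a b d e p)
  (fun a b d e => hess_curvC a b d e hp) (fun a b d e => hess_curv_bianchi a b d e hp)
  (fun a b d e => hess_curv_comm a b d e hp).
have C := curvature_contraction K_neq0_2 VT GT VG (fun a b => curvC a b hp)
  (fun a b => riemKC a b p) (fun a b => riemK_skew K Uo Uc gS gT gU a b hp)
  (fun a e => riemK_ricci a e hp) (fun a b d e => riemK_weyl a b d e hp).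
rewrite /anomaly /energy_ren.
have L := tr_laplacian_curv_sq hp; have NN := nabla_curv_up_termE hp.
have NJ := nabla_current_termE hp; have SQ := tr_curv_sq hp.
have P := schouten_termE hp; have WW := weyl_termE hp; have FFF := cubic_termE hp.
exact (anomaly_identity _ K_neq0_2 L NN NJ SQ P WW FFF B C).
Qed.

End Coupled.

(** * The identity in a chart and a trivialization *)

Lemma posdef_unitmx (R : realFieldType) n (G : 'M[R]_n) :
  (forall v : 'rV[R]_n, v != 0 -> 0 < (v *m G *m v^T) 0 0) -> G \in unitmx.
Proof.
move=> pos; rewrite -row_free_unit -kermx_eq0; apply/negPn/negP => /rowV0Pn[v].
by move=> /sub_kermxP vG /pos; rewrite vG mul0mx mxE ltxx.
Qed.

Unset Implicit Arguments.

Theorem lemma2p6 (R : realType) (X : topologicalType) (M : manifold R X)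
    (g : riemannian M) (K : fieldExtType R) (r : nat) (V : vbundle M K r)
    (A : connection V) (i : midx M) (l : vb_idx V) (p : X)
    (hi : cdom (mchart i) p) (hl : vb_dom l p) :
  anomaly (mchart i) (rm_g g i) (cn_form A i l) p =
  energy_ren (mchart i) (rm_g g i) (cn_form A i l) p.
Proof.
pose U := cdom (mchart i) `&` vb_dom l.
have Uo : open U by apply: openI; [exact: cdom_open | exact: vb_open].
have Uc : U `<=` cdom (mchart i) by move=> q [].
apply: (anomaly_energy Uo Uc) => //.
- by move=> a b; exact: smooth_sub Uc (rm_smooth g i a b).
- by move=> q [hq _]; exact: rm_sym.
- by move=> q [hq _]; apply: posdef_unitmx; exact: rm_pos.
- by move=> a; exact: cn_smooth.
Qed.
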